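(* Let $X$ be a second-countable locally compact Hausdorff space and let $\kappa$ be a kernel on $X$ satisfying the energy principle and the conditions $(\mathcal R_1)$, $(\mathcal R_2)$, $(\mathcal R_3)$, $(\mathcal R_4)$ listed in the context. Let $A\subset X$ be an arbitrary set with $\mathrm{cap}_*A>0$ whose closure $\overline A$ in $X$ satisfies $\overline A\ne X$. Put $\Omega:=X\setminus\overline A$, and let $\omega\in\mathfrak M^+(\Omega)$, $\omega\neq0$, be such that $I(\omega)<\infty$ or $\omega(X)<\infty$. Then the inner balayage $\omega^A$, uniquely determined within $\mathcal E'(A)$ by the property $U^{\omega^A}=U^\omega$ n.e. on $A$, admits the integral representation $$\omega^A=\int\varepsilon_x^A\,d\omega(x),$$ where $\varepsilon_x$ denotes the unit Dirac measure at $x\in\Omega$ and $\varepsilon_x^A$ its inner balayage to $A$. If moreover $A$ is Borel, then the integral representation holds for the outer balayage as well, i.e. $$\omega^{*A}=\int\varepsilon_x^{*A}\,d\omega(x).$$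
   Context: **Measures, potentials, energies.** $X$ is a locally compact Hausdorff space with a countable base of open sets. $C_0(X)$ is the space of continuous functions $\varphi:X\to\mathbb R$ of compact support. $\mathfrak M$ is the space of all real-valued (signed) Radon measures on $X$ with the vague topology (pointwise convergence on $C_0(X)$), and $\mathfrak M^+$ is the cone of positive ones. A kernel is a symmetric lower semicontinuous function $\kappa:X\times X\to[0,\infty]$. For $\mu,\nu\in\mathfrak M$, $I(\mu,\nu):=\int\kappa(x,y)\,d(\mu\otimes\nu)(x,y)$, $I(\mu):=I(\mu,\mu)$, and $U^\mu(x):=\int\kappa(x,y)\,d\mu(y)$, whenever the right-hand side is well defined as a finite number or $\pm\infty$. For $Q\subset X$, $\mathfrak M^+(Q)$ is the set of $\mu\in\mathfrak M^+$ concentrated on $Q$, i.e. for which $Q^c:=X\setminus Q$ is $\mu$-negligible. **Energy principle.** $\kappa$ is strictly positive definite: $I(\mu)\ge0$ for all signed $\mu\in\mathfrak M$ (for which it is well defined), and $I(\mu)=0$ only for $\mu=0$. Then the set $\mathcal E$ of all (signed) $\mu\in\mathfrak M$ of finite energy is a pre-Hilbert space with inner product $I(\mu,\nu)$ and norm $\|\mu\|=\sqrt{I(\mu)}$; its norm topology is called strong. $\mathcal E^+:=\mathcal E\cap\mathfrak M^+$, $\mathcal E^+(Q):=\mathcal E\cap\mathfrak M^+(Q)$, and $\mathcal E'(Q)$ is the closure of $\mathcal E^+(Q)$ in the strong topology on $\mathcal E^+$. **Conditions on the kernel.** - $(\mathcal R_1)$: $\kappa$ is perfect, i.e. it satisfies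 the energy principle, $\mathcal E^+$ is complete in the strong topology, and the strong topology on $\mathcal E^+$ is finer than the vague topology on $\mathcal E^+$. Moreover, $\kappa$ satisfies the domination principle: for any $\mu\in\mathcal E^+$ and $\nu\in\mathfrak M^+$ with $U^\mu\le U^\nu$ $\mu$-a.e., the same inequality holds on all of $X$. It also satisfies the $h$-Ugaheri maximum principle: there is $h\in[1,\infty)$, depending on $X$ and $\kappa$ only, such that for each $\mu\in\mathcal E^+$ with $U^\mu\le c_\mu$ $\mu$-a.e., where $c_\mu\in(0,\infty)$, we have $U^\mu\le hc_\mu$ on all of $X$. - $(\mathcal R_2)$: $\kappa(x,y)$ is continuous (with finite values) for $x\ne y$. - $(\mathcal R_3)$: $\kappa(\cdot,y)\to0$ uniformly on compact subsets of $X$ as $y\to\infty_X$, where $\infty_X$ is the Alexandroff point of $X$. - $(\mathcal R_4)$: the set of all $\varphi\in C_0(X)$ representable as potentials $U^\theta$ of measures $\theta\in\mathcal E$ is dense in $C_0(X)$ equipped with the inductive limit topology, i.e. the finest locally convex topology making all the inclusions $C_0(K;X)\to C_0(X)$ continuous, where $K\subset X$ is compact and $C_0(K;X)$ is the space of $\varphi\in C_0(X)$ with support in $K$, with the topology of uniform convergence on $K$. **Capacities.** For compact $K$, $\mathrm{cap}\,K:=1/\inf\{I(\mu):\mu\in\mathcal E^+(K),\ \mu(X)=1\}$ (with $\inf\varnothing=\infty$, $1/\infty=0$). For $Q\subset X$, the inner capacity is $\mathrm{cap}_*Q:=\sup\{\mathrm{cap}\,K: K\subset Q \text{ compact}\}$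 and the outer capacity is $\mathrm{cap}^*Q:=\inf\{\mathrm{cap}_*G: G\supset Q\text{ open}\}$. A property holds n.e. (nearly everywhere), respectively q.e. (quasi-everywhere), on $Q$ if the set of points of $Q$ where it fails has inner, respectively outer, capacity zero. **Balayage.** Let $\mu\in\mathfrak M^+$, $\mu\ne0$, be such that either $I(\mu)<\infty$, or $\mu\in\mathfrak M^+(A^c)$ and $\mu(X)<\infty$. It is known that, under $(\mathcal R_1)$–$(\mathcal R_3)$, there is exactly one measure $\mu^A\in\mathcal E'(A)$ with $U^{\mu^A}=U^\mu$ n.e. on $A$; it is called the inner balayage of $\mu$ to $A$. If $A$ is Borel, the same measure is the outer balayage $\mu^{*A}$, which is the unique measure in $\mathcal E'(A)$ with $U^{\mu^{*A}}=U^\mu$ q.e. on $A$. This applies to $\mu=\omega$ and to $\mu=\varepsilon_x$, $x\in\Omega$. **Meaning of the integral.** The equality $\omega^A=\int\varepsilon_x^A\,d\omega(x)$ means that for every $\varphi\in C_0(X)$ the function $x\mapsto\int\varphi\,d\varepsilon_x^A$ on $\Omega$ is $\omega$-integrable and $\int\varphi\,d\omega^A=\int\bigl(\int\varphi\,d\varepsilon_x^A\bigr)\,d\omega(x)$; similarly for the outer balayage. *)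

(* Defs.v *)
From HB Require Import structures.
From mathcomp Require Import all_boot all_order all_algebra.
From mathcomp Require Import all_classical all_reals all_analysis.

Set Implicit Arguments.
Unset Strict Implicit.
Unset Printing Implicit Defensive.

Import Order.TTheory GRing.Theory Num.Theory.
Import numFieldNormedType.Exports.

Local Open Scope classical_set_scope.
Local Open Scope ring_scope.

Notation borel X := (g_sigma_algebraType (@open X)).

Notation borel_measure X R := {measure set (borel X) -> \bar R}.

Section space.
Context {R : realType} {X : ptopologicalType}.

Definition supp (phi : X -> R) : set X := closure [set x | phi x != 0].

Definition C0 : set (X -> R) :=
  [set phi | continuous phi /\ compact (supp phi)].

Definition C0_in (K : set X) : set (X -> R) :=
  [set phi | C0 phi /\ supp phi `<=` K].

(* On a second-countable locally compact Hausdorff space every Borel measure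
   that is finite on compact sets is regular, so that these are exactly the
   positive Radon measures. *)
Definition Mplus : set (borel_measure X R) :=
  [set mu | forall K : set X, compact K -> (mu K < +oo)%E].

Definition Mplus_on (Q : set X) : set (borel_measure X R) :=
  [set mu | Mplus mu /\ mu.-negligible (~` Q)].

(* The values of a measure outside the sigma-algebra are not specified, hence
   equality of measures is equality on the Borel sets. *)
Definition same_measure (mu nu : borel_measure X R) :=
  forall B : set (borel X), measurable B -> mu B = nu B.

Definition zero_measure (mu : borel_measure X R) :=
  forall B : set (borel X), measurable B -> mu B = 0%E.

Definition unit_mass (x : X) : borel_measure X R := dirac (x : borel X).

(* A signed Radon measure is given by its Jordan decomposition (s^+, s^-); when
   X is not compact both parts may have infinite mass, so s is in general not a
   set function on the whole sigma-algebra. *)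
Definition signed_Radon : set (borel_measure X R * borel_measure X R) :=
  [set s | [/\ Mplus s.1, Mplus s.2 &
    exists P : set (borel X), [/\ measurable P, s.1 (~` P) = 0%E & s.2 P = 0%E]]].

Definition zero_signed (s : borel_measure X R * borel_measure X R) :=
  zero_measure s.1 /\ zero_measure s.2.

(* A locally convex topology on the vector space C0, presented as a locally
   convex space together with a linear bijection onto C0. *)
Record lc_topology_C0 := LCTopologyC0 {
  lcs : tvsType R ;
  lcs_fun : {linear lcs -> (X -> R^o)} ;
  lcs_fun_inj : injective lcs_fun ;
  lcs_fun_range : range lcs_fun = C0 }.

(* For every compact K the inclusion of C0_in K, equipped with the topology of
   uniform convergence on K, into C0 is continuous. *)
Definition continuous_inclusions (T : lc_topology_C0) :=
  forall K : set X, compact K ->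
  forall t : lcs T, C0_in K (lcs_fun T t) ->
  forall U : set (lcs T), nbhs t U ->
  exists2 e : R, 0 < e & forall s : lcs T, C0_in K (lcs_fun T s) ->
    (forall x, K x -> `|lcs_fun T s x - lcs_fun T t x| < e) -> U s.

Definition finer_C0 (T T' : lc_topology_C0) :=
  forall id : lcs T -> lcs T',
    (forall t, lcs_fun T' (id t) = lcs_fun T t) -> continuous id.

Definition inductive_limit_topology (T : lc_topology_C0) :=
  continuous_inclusions T /\
  forall T' : lc_topology_C0, continuous_inclusions T' -> finer_C0 T T'.

Definition dense_in_C0 (D : set (X -> R)) :=
  exists2 T : lc_topology_C0, inductive_limit_topology T &
    dense [set t : lcs T | D (lcs_fun T t)].

End space.

Section potential_theory.
Context {R : realType} {X : ptopologicalType}.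
Variable kappa : X -> X -> \bar R.
Implicit Types mu nu : borel_measure X R.
Implicit Types s t : borel_measure X R * borel_measure X R.
Local Open Scope ereal_scope.

Definition is_kernel :=
  [/\ forall x y, 0 <= kappa x y,
      forall x y, kappa x y = kappa y x &
      lower_semicontinuous (fun p : X * X => kappa p.1 p.2)].

Definition mutual_energy mu nu : \bar R :=
  \int[mu \x nu]_p kappa p.1 p.2.

Definition energy mu := mutual_energy mu mu.

Definition potential mu (x : X) : \bar R := \int[mu]_y kappa x y.

(* Integrals of kappa against the positive and the negative part of the signed
   measure s (x) t. *)
Definition mutual_energy_pos s t :=
  mutual_energy s.1 t.1 + mutual_energy s.2 t.2.
Definition mutual_energy_neg s t :=
  mutual_energy s.1 t.2 + mutual_energy s.2 t.1.

Definition signed_energy_defined s :=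
  mutual_energy_pos s s < +oo \/ mutual_energy_neg s s < +oo.

Definition signed_energy s := mutual_energy_pos s s - mutual_energy_neg s s.

Definition energy_principle :=
  forall s, signed_Radon s -> signed_energy_defined s ->
    0 <= signed_energy s /\ (signed_energy s = 0 -> zero_signed s).

Definition finite_energy : set (borel_measure X R * borel_measure X R) :=
  [set s | [/\ signed_Radon s, signed_energy_defined s &
               signed_energy s \is a fin_num]].

Definition Eplus : set (borel_measure X R) :=
  [set mu | Mplus mu /\ energy mu < +oo].

Definition Eplus_on (Q : set X) : set (borel_measure X R) :=
  [set mu | Eplus mu /\ Mplus_on Q mu].

(* For mu, nu in Eplus this is sqrt (I (mu - nu)), expanded by bilinearity; all
   three energies are finite when the energy principle holds. *)
Definition strong_dist mu nu : R :=
  Num.sqrt (fine (energy mu) - 2 * fine (mutual_energy mu nu)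
            + fine (energy nu)).

Definition strong_nbhs mu (U : set (borel_measure X R)) :=
  exists2 e : R, (0 < e)%R &
    forall nu, Eplus nu -> (strong_dist mu nu < e)%R -> U nu.

Definition vague_nbhs mu (U : set (borel_measure X R)) :=
  exists n (phi : 'I_n -> X -> R) (e : R),
  [/\ forall i, C0 (phi i), (0 < e)%R &
      forall nu, Eplus nu ->
        (forall i, `|\int[nu]_x phi i x - \int[mu]_x phi i x| < e)%R -> U nu].

Definition strong_closure (F : set (borel_measure X R)) :
    set (borel_measure X R) :=
  [set mu | Eplus mu /\
    forall U, strong_nbhs mu U -> exists2 nu, F nu & U nu].

Definition Eprime (Q : set X) := strong_closure (Eplus_on Q).

(* The strong topology is metrizable, so sequences suffice. *)
Definition strongly_complete :=
  forall u : nat -> borel_measure X R, (forall n, Eplus (u n)) ->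
    (forall e : R, (0 < e)%R -> exists N, forall m n,
      (N <= m)%N -> (N <= n)%N -> (strong_dist (u m) (u n) < e)%R) ->
    exists2 mu, Eplus mu & strong_dist (u n) mu @[n --> \oo] --> (0%R : R).

Definition strong_finer_than_vague :=
  forall mu U, Eplus mu -> vague_nbhs mu U -> strong_nbhs mu U.

Definition perfect :=
  [/\ energy_principle, strongly_complete & strong_finer_than_vague].

Definition domination_principle :=
  forall mu nu, Eplus mu -> Mplus nu ->
    {ae mu, forall x, potential mu x <= potential nu x} ->
    forall x, potential mu x <= potential nu x.

Definition Ugaheri_principle :=
  exists2 h : R, (1 <= h)%R & forall mu (c : R), Eplus mu -> (0 < c)%R ->
    {ae mu, forall x, potential mu x <= c%:E} ->
    forall x, potential mu x <= (h * c)%:E.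

Definition R1 := [/\ perfect, domination_principle & Ugaheri_principle].

Definition R2 := forall p : X * X, p.1 <> p.2 ->
  kappa p.1 p.2 \is a fin_num /\
  {for p, continuous (fun q : X * X => kappa q.1 q.2)}.

(* None is the Alexandroff point of X; when X is compact it is isolated and the
   condition is void. *)
Definition R3 := forall K : set X, compact K -> forall e : R, (0 < e)%R ->
  \forall z \near (None : one_point_compactification X),
    forall y, z = Some y -> forall x, K x -> kappa x y < e%:E.

(* The potential of a signed measure is a difference of two potentials; since
   +oo - +oo = -oo, the equation below forces both of them to be finite. *)
Definition R4 := dense_in_C0
  [set phi : X -> R | C0 phi /\ exists2 s, finite_energy s &
     forall x, potential s.1 x - potential s.2 x = (phi x)%:E].

(* The inverse on \bar R satisfies 0^-1 = +oo and +oo^-1 = 0. *)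
Definition cap (K : set X) : \bar R :=
  (ereal_inf [set energy mu | mu in
    [set mu | Eplus_on K mu /\ mu [set: X] = 1]])^-1.

Definition inner_cap (Q : set X) : \bar R :=
  ereal_sup [set cap K | K in [set K | compact K /\ K `<=` Q]].

Definition outer_cap (Q : set X) : \bar R :=
  ereal_inf [set inner_cap G | G in [set G | open G /\ Q `<=` G]].

Definition nearly_everywhere (Q P : set X) := inner_cap (Q `\` P) = 0.

Definition quasi_everywhere (Q P : set X) := outer_cap (Q `\` P) = 0.

Definition inner_balayage (A : set X) mu nu :=
  Eprime A nu /\ nearly_everywhere A [set x | potential nu x = potential mu x].

Definition outer_balayage (A : set X) mu nu :=
  Eprime A nu /\ quasi_everywhere A [set x | potential nu x = potential mu x].

End potential_theory.

(* nu is the integral of the family (lambda x), x in D, with respect to mu. *)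
Definition integral_representation {R : realType} {X : ptopologicalType}
    (nu : borel_measure X R) (D : set X) (mu : borel_measure X R)
    (lambda : X -> borel_measure X R) :=
  forall phi : X -> R, C0 phi ->
    mu.-integrable D (fun x => \int[lambda x]_y (phi y)%:E)%E /\
    (\int[nu]_y (phi y)%:E =
     \int[mu]_(x in D) (\int[lambda x]_y (phi y)%:E))%E.

(* Main.v *)
(** For a measure [theta] of finite energy let [p n] be its projections, in the
    pre-Hilbert space of measures of finite energy, onto the cones of measures
    carried by compact sets [K n] increasing inside [A]. By the domination
    principle the potentials [U (p n)] increase with [n] and stay below
    [U theta]; if the [K n] are chosen so that the distances from [theta] decrease
    to its distance from all measures carried by [A], then [I (p n, lam)] tends to
    [I (theta, lam)] for each [lam] in [Eprime A]. As [p n] is carried by [A] and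
    charges no set of inner capacity zero, [I (p n, eps_x^A) = U (p n) x] and
    [I (p n, omega^A) = I (p n, omega)], the integral of [U (p n)] against
    [omega]. Monotone convergence then gives
    [I (theta, omega^A) = \int I (theta, eps_x^A) domega(x)], that is, the
    representation tested against [U theta].

    By linearity it holds for the test functions that are potentials of signed
    measures. To reach an arbitrary [phi], approximate it within [w / j], where
    [w] is bounded below on compact sets and lies below a series
    [\sum_n c_n U (eta n)] with [\sum_n c_n I (eta n, lam) <= ||lam||] for all
    [lam] of finite energy; this is possible because the norm [sup |phi| / w] is
    continuous for the inductive limit topology. The error is then controlled at
    every point of [Omega], and dominated convergence concludes. *)

Require Import Defs.
From HB Require Import structures.
From mathcomp Require Import all_boot all_order all_algebra.
From mathcomp Require Import all_classical all_reals all_analysis measurable_realfun.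
From mathcomp Require Import ring lra.

Set Implicit Arguments.
Unset Strict Implicit.
Unset Printing Implicit Defensive.

Import Order.TTheory GRing.Theory Num.Theory.
Import numFieldNormedType.Exports.

Local Open Scope classical_set_scope.
Local Open Scope ring_scope.

(** * Quadratic inequalities and comparison of integrals *)

Lemma discriminant_le (R : realFieldType) (a b c : R) : 0 <= c ->
  (forall s, 0 <= a - 2 * s * b + s ^+ 2 * c) -> b ^+ 2 <= a * c.
Proof.
rewrite le_eqVlt => /predU1P[<-|c0] h.
- rewrite mulr0; have [-> |b0] := eqVneq b 0; first by rewrite expr0n.
  (* With [c = 0] and [b] nonzero the expression is affine in [s], and this [s] gives it the value
     [-1]. *)
  have := h ((a + 1) / (2 * b)); rewrite mulr0 addr0.
  have -> : 2 * ((a + 1) / (2 * b)) * b = a + 1 by field.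
  lra.
- have := h (b / c); set s := b / c; have -> : b = s * c by rewrite /s divfK ?gt_eqF.
  move=> hs; rewrite -subr_ge0.
  have -> : a * c - (s * c) ^+ 2 = c * (a - 2 * s * (s * c) + s ^+ 2 * c) by ring.
  by rewrite mulr_ge0// ltW.
Qed.

(** This is the first-order condition at a minimum: divide by [t] and let [t] tend to 0. The range
    stops at 1 because one of the variations used later is [(1 - t) p], which must stay a positive
    measure. *)
Lemma linear_le_quadratic (R : realFieldType) (g L : R) : 0 <= L ->
  (forall t, 0 < t -> t <= 1 -> 2 * t * g <= t ^+ 2 * L) -> g <= 0.
Proof.
move=> L0 h; rewrite leNgt; apply/negP => g0.
(* Here [t * L <= g], so the hypothesis divided by [t] would give [2 * g <= g]. *)
pose t := g / (L + g + 1).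
have c0 : 0 < L + g + 1 by lra.
have t0 : 0 < t by rewrite divr_gt0.
have t1 : t <= 1 by rewrite /t ler_pdivrMr// mul1r; lra.
have gE : g = t * (L + g + 1) by rewrite /t divfK// gt_eqF.
have := h t t0 t1; rewrite expr2 -mulrA [leLHS]mulrCA -[leRHS]mulrA ler_pM2l//.
move=> h'; have : t * (L + g + 1) * 2 <= t * L by rewrite -gE mulrC.
rewrite -mulrA ler_pM2l//; lra.
Qed.

Lemma cvg_le_harmonic (R : realType) (a : nat -> R) (l b : R) :
  (forall j, `|a j - l| <= j.+1%:R^-1 * b) -> a @ \oo --> l.
Proof.
move=> h; apply/cvgrPdist_le => e e0.
have b0 : 0 <= b by have := h 0%N; rewrite invr1 mul1r; apply: le_trans.
have b1 : 0 < b + 1 by rewrite ltr_wpDl.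
have c0 : 0 < e / (b + 1) by rewrite divr_gt0.
have [N _ hN] := near_infty_natSinv_lt (PosNum c0).
exists N => // j /= Nj; rewrite distrC; apply: le_trans (h j) _.
have /ltW := hN j Nj; rewrite /= ler_pdivlMr// => /(le_trans _); apply.
by rewrite ler_wpM2l ?invr_ge0// lerDl.
Qed.

(** [g - f] is nonnegative almost everywhere and has integral at most 0, hence vanishes almost
    everywhere; finiteness of both integrals makes the subtraction legitimate. *)
Lemma ae_eq_of_integral_le d (T : measurableType d) (R : realType)
    (m : {measure set T -> \bar R}) (f g : T -> \bar R) :
  measurable_fun setT f -> measurable_fun setT g ->
  (forall x, (0 <= f x)%E) -> (forall x, (0 <= g x)%E) ->
  {ae m, forall x, (f x <= g x)%E} ->
  (\int[m]_x g x <= \int[m]_x f x)%E -> (\int[m]_x f x < +oo)%E ->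
  {ae m, forall x, f x = g x}.
Proof.
move=> mf mg f0 g0 fg gf fy.
have intf : m.-integrable setT f.
  apply/integrableP; split => //; under eq_integral do rewrite gee0_abs//.
  exact: fy.
have intg : m.-integrable setT g.
  apply/integrableP; split => //; under eq_integral do rewrite gee0_abs//.
  exact: le_lt_trans fy.
have mgf : measurable_fun setT (g \- f)%E by exact: emeasurable_funB.
have aef := integrable_ae measurableT intf.
have aeg := integrable_ae measurableT intg.
have : (\int[m]_x `|(g \- f) x| = 0)%E.
  rewrite [LHS](_ : _ = \int[m]_x (g \- f) x)%E; last first.
    apply: ae_eq_integral => //; first exact: measurableT_comp.
    apply: filterS2 aef fg => x fx le _; rewrite gee0_abs// sube_ge0//.
    by rewrite fx.
  apply/eqP; rewrite eq_le; apply/andP; split.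
    by rewrite integralB// sube_le0.
  rewrite (_ : (\int[m]_x (g \- f) x)%E = (\int[m]_x `|(g \- f) x|)%E).
    exact: integral_ge0.
  apply: ae_eq_integral => //; first exact: measurableT_comp.
  apply: filterS2 aef fg => x fx le _; rewrite gee0_abs// sube_ge0//.
  by rewrite fx.
move/(ae_eq_integral_abs m measurableT mgf) => ae0.
apply: filterS3 ae0 aef aeg => x /(_ I) e0 fx gx.
move: e0; rewrite /= -(fineK (fx I)) -(fineK (gx I)) -EFinB => -[] /eqP.
by rewrite subr_eq0 => /eqP ->.
Qed.

Lemma ge0_integral_mrestr d (T : measurableType d) (R : realType)
    (m : {measure set T -> \bar R}) (D : set T) (mD : measurable D)
    (f : T -> \bar R) : measurable_fun setT f -> (forall x, (0 <= f x)%E) ->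
  (\int[mrestr m mD]_x f x = \int[m]_(x in D) f x)%E.
Proof.
move=> mf f0.
have D0 : mrestr m mD (~` D) = 0%E by rewrite /mrestr setICl measure0.
rewrite (ge0_negligible_integral (measurableC mD) measurableT mf (fun x _ => f0 x) D0).
rewrite setTD setCK; apply: eq_measure_integral => A mA AD.
by rewrite /= /mrestr setIidl.
Qed.

(** * Jordan decomposition of a difference of measures *)

Section jordan.
Context d (T : measurableType d) (R : realType).
Local Open Scope ereal_scope.

(** With [P] the positive Hahn set of [a - b], the common part is [b] on [P] and [a] off [P], which
    is the minimum of the two measures; what remains of [a] and of [b] is the Jordan pair of
    [a - b]. *)
Lemma finite_measure_jordan (a b : {finite_measure set T -> \bar R}) :
  exists s : {measure set T -> \bar R} * {measure set T -> \bar R} *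
             {measure set T -> \bar R},
  exists P, [/\ measurable P,
    forall B, measurable B -> a B = s.1.1 B + s.2 B,
    forall B, measurable B -> b B = s.1.2 B + s.2 B,
    s.1.1 (~` P) = 0 & s.1.2 P = 0].
Proof.
pose nu := cadd (charge_of_finite_measure a) (cscale (-1) (charge_of_finite_measure b)).
have nuE B : nu B = a B - b B by rewrite /nu /cadd/= /cscale mulN1e.
have [P [N nuPN]] := Hahn_decomposition nu.
have [[mP _] [mN _] PNT PN0] := nuPN.
have NE : N = ~` P.
  apply/seteqP; split => x; first by move=> Nx Px; have : set0 x by rewrite -PN0.
  by move=> nPx; have : setT x by []; rewrite -PNT => -[].
have jpE B : measurable B -> jordan_pos nuPN B = a (B `&` P) - b (B `&` P).
  by move=> mB; rewrite jordan_posE cjordan_posE /crestr0 mem_set//; exact: nuE.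
have jnE B : measurable B -> jordan_neg nuPN B = b (B `&` N) - a (B `&` N).
  move=> mB; rewrite jordan_negE cjordan_negE /crestr0 mem_set// /crestr.
  rewrite [X in - X]nuE oppeB 1?addeC// fin_num_adde_defl//.
  by rewrite fin_numN; apply: fin_num_measure; exact: measurableI.
have mE B : measure_add (mrestr b mP) (mrestr a mN) B = b (B `&` P) + a (B `&` N).
  by rewrite measure_addE.
have split (c : {measure set T -> \bar R}) B : measurable B ->
    c B = c (B `&` P) + c (B `&` N).
  move=> mB; rewrite -measureU ?NE//.
  - by rewrite -setIUr setUv setIT.
  - exact: measurableI.
  - by apply: measurableI => //; exact: measurableC.
  - by rewrite setIACA setICr setI0.
exists ((jordan_pos nuPN : {measure set T -> \bar R},
   jordan_neg nuPN : {measure set T -> \bar R}),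
   (measure_add (mrestr b mP) (mrestr a mN) : {measure set T -> \bar R})), P.
split => //.
- move=> B mB; rewrite [LHS](split a B mB) [X in _ = X + _](jpE B mB).
  rewrite [X in _ = _ + X]mE addeA subeK//.
  by apply: fin_num_measure; exact: measurableI.
- move=> B mB; rewrite [LHS](split b B mB) [X in _ = X + _](jnE B mB).
  rewrite [X in _ = _ + X]mE (addeC (b _) (a _)) addeA subeK 1?addeC//.
  by apply: fin_num_measure; exact: measurableI.
- by rewrite [LHS](jpE _ (measurableC mP)) setICl !measure0 sube0.
- by rewrite [LHS](jnE _ mP) PN0 !measure0 sube0.
Qed.

(** The difference of two infinite measures need not be a charge, so the finite decomposition is
    applied on each piece [F i] and the results are summed. *)
Lemma sigma_finite_jordan (mu nu : {measure set T -> \bar R}) (F : nat -> set T) :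
  (forall i, measurable (F i)) -> trivIset setT F -> \bigcup_i F i = setT ->
  (forall i, mu (F i) < +oo) -> (forall i, nu (F i) < +oo) ->
  exists s1 s2 m : {measure set T -> \bar R}, exists P, [/\ measurable P,
    forall B, measurable B -> mu B = s1 B + m B,
    forall B, measurable B -> nu B = s2 B + m B,
    s1 (~` P) = 0 & s2 P = 0].
Proof.
move=> mF tF FT muF nuF.
have /choice[s sP] i := finite_measure_jordan (mfrestr (mF i) (muF i))
  (mfrestr (mF i) (nuF i)).
have {sP}/choice[P PP] i := sP i.
have mP i : measurable (P i) by case: (PP i).
pose S1 i := (s i).1.1; pose S2 i := (s i).1.2; pose M i := (s i).2.
have out (c : {measure set T -> \bar R}) i (t u : {measure set T -> \bar R}) :
    (forall B, measurable B -> mrestr c (mF i) B = t B + u B) -> t (~` F i) = 0.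
  move=> h; have := h _ (measurableC (mF i)).
  rewrite /mrestr setICl measure0 => /esym/eqP.
  by rewrite padde_eq0// => /andP[/eqP].
have S1out i : S1 i (~` F i) = 0.
  by apply: (out mu _ _ (M i)); case: (PP i).
have S2out i : S2 i (~` F i) = 0.
  by apply: (out nu _ _ (M i)); case: (PP i).
(* Each [S1 i] and [S2 i] lives on [F i], so the sets [P i], cut down to [F i] and glued together,
   separate the two sums. *)
have mQ : measurable (\bigcup_i (P i `&` F i)).
  by apply: bigcup_measurable => i _; exact: measurableI.
have sum (c : {measure set T -> \bar R}) (t u : nat -> {measure set T -> \bar R}) B :
    (forall i B, measurable B -> mrestr c (mF i) B = t i B + u i B) ->
    measurable B -> c B = mseries t 0 B + mseries u 0 B.
  move=> h mB; rewrite /mseries -nneseriesD//.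
  rewrite -[in LHS](setIT B) -FT setI_bigcupr measure_semi_bigcup//; first last.
  - by rewrite -setI_bigcupr FT setIT.
  - exact: trivIset_setIl.
  - by move=> i; exact: measurableI.
  by apply: eq_eseriesr => i _; rewrite -h.
exists (mseries S1 0), (mseries S2 0), (mseries M 0), (\bigcup_i (P i `&` F i)).
split => //.
- by move=> B mB; apply: sum => // i; case: (PP i).
- by move=> B mB; apply: sum => // i; case: (PP i).
- rewrite /= /mseries; apply: eseries0 => i _ _; apply/eqP.
  rewrite eq_le measure_ge0 andbT.
  rewrite -(adde0 0) -{1}(S1out i).
  have <- : S1 i (~` P i) = 0 by case: (PP i).
  apply: le_trans (measureU2 _ _ _); try exact: measurableC.
  apply: le_measure; rewrite ?inE.
  + exact: measurableC.
  + by apply: measurableU; exact: measurableC.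
  + move=> x nQ; rewrite -setCI => -[Fx Px]; apply: nQ; by exists i.
- rewrite /= /mseries; apply: eseries0 => i _ _; apply/eqP.
  rewrite eq_le measure_ge0 andbT.
  rewrite -(adde0 0) -{1}(S2out i).
  have <- : S2 i (P i) = 0 by case: (PP i).
  apply: le_trans (measureU2 _ _ _) => //; last exact: measurableC.
  apply: le_measure; rewrite ?inE//.
  + by apply: measurableU => //; exact: measurableC.
  + move=> x [j _ [Px Fx]].
    have [Fix|nFix] := pselect (F i x); last by left.
    right; suff -> : i = j by [].
    by apply/(tF i j I I); exists x.
Qed.

End jordan.

Lemma C0_bounded {R : realType} {X : ptopologicalType} (phi : X -> R) : C0 phi ->
  exists2 M, 0 <= M & forall x, `|phi x| <= M.
Proof.
move=> [cphi cs].
have : compact (phi @` supp phi).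
  by apply: continuous_compact => //; exact: continuous_subspaceT.
move=> /compact_bounded[M [_ /(_ (`|M| + 1))]].
rewrite (le_lt_trans (ler_norm M)) ?ltrDl// => /(_ isT) h.
exists (`|M| + 1) => [|x]; first by rewrite addr_ge0.
have [->|phix] := eqVneq (phi x) 0; first by rewrite normr0 addr_ge0.
by apply: h; exists x => //; exact: subset_closure.
Qed.

(** * Weighted supremum norms on compactly supported functions *)

Section weighted_norm.
Context {R : realType} {X : ptopologicalType}.

Definition C0_pred : {pred X -> R^o} := fun f => `[< C0 (f : X -> R) >].

Lemma C0_submod_closed : submod_closed C0_pred.
Proof.
split.
  apply/asboolP; split; first by move=> x; exact: cvg_cst.
  rewrite (_ : supp _ = set0); first exact: compact0.
  by rewrite -closure0; congr closure; apply/seteqP; split => x //=; rewrite eqxx.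
move=> a f g /asboolP[cf sf] /asboolP[cg sg]; apply/asboolP; split.
  by move=> x; apply: cvgD; [apply: cvgZr; exact: cf|exact: cg].
apply: (@subclosed_compact _ _ (supp f `|` supp g)).
- exact: closed_closure.
- exact: compactU.
- rewrite -closureU; apply: closure_subset => x /= fg.
  have [fx|fx] := eqVneq (f x) 0; last by left.
  right => /=; apply: contra_neq fg => gx.
  by change (a *: f x + g x = 0); rewrite fx gx scaler0 addr0.
Qed.

HB.instance Definition _ := GRing.isSubmodClosed.Build R (X -> R^o) C0_pred
  C0_submod_closed.

Definition C0_type := {f : X -> R^o | f \in C0_pred}.

HB.instance Definition _ := SubChoice.on C0_type.
HB.instance Definition _ := [SubChoice_isSubLmodule of C0_type by <:].

Record weight := Weight {
  weight_fun : X -> R ;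
  weight_gt0 : forall x, 0 < weight_fun x ;
  weight_compact : forall K, compact K ->
    exists2 c : R, 0 < c & forall x, K x -> c <= weight_fun x }.

(** A copy of [C0_type] tagged by the weight, so that each weight can carry its own norm
    instance. *)
Definition weighted of weight := C0_type.
HB.instance Definition _ w := GRing.Lmodule.copy (weighted w) C0_type.

Section norm.
Variable w : weight.
Implicit Types f g : weighted w.

Definition weighted_fun f : X -> R^o := val f.

Lemma weighted_funP f : C0 (weighted_fun f).
Proof. by apply/asboolP; exact: (valP f). Qed.

Lemma weighted_fun_is_linear : linear weighted_fun.
Proof. by []. Qed.

HB.instance Definition _ := GRing.isLinear.Build R (weighted w) (X -> R^o) *:%R
  weighted_fun weighted_fun_is_linear.

Definition wnorm f : R := sup [set `|weighted_fun f x : R| / weight_fun w x | x in setT].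

Lemma wnorm_has_sup f :
  has_sup [set `|weighted_fun f x : R| / weight_fun w x | x in setT].
Proof.
split; first by exists (`|weighted_fun f point| / weight_fun w point); exists point.
have hf := weighted_funP f; have [M M0 hM] := C0_bounded hf.
have [c c0 hc] := weight_compact w hf.2.
exists (M / c) => _ [x _ <-].
have [->|fx] := eqVneq (weighted_fun f x) 0.
  by rewrite normr0 mul0r divr_ge0// ltW.
apply: ler_pM => //; first by rewrite invr_ge0 ltW// weight_gt0.
rewrite lef_pV2 ?posrE ?weight_gt0//; apply: hc; exact: subset_closure.
Qed.

Lemma wnorm_ge f x : `|weighted_fun f x : R| <= wnorm f * weight_fun w x.
Proof.
rewrite -ler_pdivrMr ?weight_gt0//; apply: sup_ubound; last by exists x.
exact: (wnorm_has_sup f).2.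
Qed.

Lemma wnorm_ge0 f : 0 <= wnorm f.
Proof.
by rewrite -(pmulr_lge0 _ (weight_gt0 w point)) (le_trans _ (wnorm_ge f point)).
Qed.

Lemma wnorm_le f M : (forall x, `|weighted_fun f x : R| <= M * weight_fun w x) ->
  wnorm f <= M.
Proof.
move=> h; apply: ge_sup; first exact: (wnorm_has_sup f).1.
by move=> _ [x _ <-]; rewrite ler_pdivrMr ?weight_gt0.
Qed.

Lemma wnormD f g : wnorm (f + g) <= wnorm f + wnorm g.
Proof.
apply: wnorm_le => x; rewrite raddfD mulrDl.
by apply: le_trans (ler_normD _ _) _; apply: lerD; exact: wnorm_ge.
Qed.

Lemma wnormZ (l : R) f : wnorm (l *: f) = `|l| * wnorm f.
Proof.
have le (k : R) h : wnorm (k *: h) <= `|k| * wnorm h.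
  apply: wnorm_le => x; rewrite linearZ [X in `|X|](_ : _ = k * weighted_fun h x)//.
  by rewrite normrM -mulrA ler_wpM2l// wnorm_ge.
apply/eqP; rewrite eq_le le /=.
have [->|l0] := eqVneq l 0.
  by rewrite normr0 mul0r wnorm_ge0.
rewrite mulrC -ler_pdivlMr ?normr_gt0// mulrC -normfV.
by have := le l^-1 (l *: f); rewrite scalerA mulVf// scale1r.
Qed.

Lemma wnorm_eq0 f : wnorm f = 0 -> f = 0.
Proof.
move=> f0; apply: val_inj; apply/funext => x; apply/eqP; rewrite -normr_le0.
by have := wnorm_ge f x; rewrite f0 mul0r.
Qed.

HB.instance Definition _ := Lmodule_isNormed.Build R (weighted w)
  wnormD wnormZ wnorm_eq0.

Lemma weighted_fun_inj : injective weighted_fun.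
Proof. exact: val_inj. Qed.

Lemma weighted_fun_range : range weighted_fun = C0.
Proof.
apply/seteqP; split => [_ [f _ <-]|f hf]; first exact: weighted_funP.
have hf' : f \in C0_pred by apply/asboolP.
by exists (exist _ f hf' : weighted w).
Qed.

Definition weighted_topology : lc_topology_C0 :=
  LCTopologyC0 (lcs := weighted w) (lcs_fun := weighted_fun)
    weighted_fun_inj weighted_fun_range.

(** For functions supported in [K] the norm is at most the supremum over [K] divided by a lower
    bound [c] of the weight there. *)
Lemma weighted_continuous_inclusions : continuous_inclusions weighted_topology.
Proof.
move=> K cK t [_ tK] U /(@nbhs_normP R (weighted w))[e /= e0 eU].
have [c c0 hc] := weight_compact w cK.
exists (e * c / 2); first by rewrite divr_gt0// mulr_gt0.
move=> s [_ sK] h; apply: eU => /=.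
apply: (@le_lt_trans _ _ (e / 2)); last by rewrite ltr_pdivrMr// ltr_pMr// ltr1n.
apply: wnorm_le => x; rewrite raddfB.
have [Kx|nKx] := pselect (K x).
  rewrite distrC; apply: (le_trans (ltW (h x Kx))).
  by rewrite mulrAC ler_wpM2l ?hc// divr_ge0// ltW.
have z (f : weighted w) : supp (weighted_fun f) `<=` K -> weighted_fun f x = 0.
  move=> fK; apply: contrapT => /eqP fx; apply: nKx; apply: fK.
  exact: subset_closure.
rewrite [X in `|X|](_ : _ = weighted_fun t x - weighted_fun s x)// z// z//.
by rewrite subrr normr0 mulr_ge0 ?divr_ge0 ?ltW// weight_gt0.
Qed.

(** The inductive limit topology is finer than every locally convex topology with continuous
    inclusions, hence than that of the weighted norm. A ball of this norm is therefore open for it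
    and meets a dense set. *)
Lemma dense_in_C0_weighted (D : set (X -> R)) (phi : X -> R) (e : R) :
  dense_in_C0 D -> C0 phi -> 0 < e ->
  exists2 psi, D psi & forall x, `|psi x - phi x| <= e * weight_fun w x.
Proof.
move=> [T [Tc Tfine] dD] hphi e0.
have /choice[id idP] (t : lcs T) : exists s : weighted w,
    weighted_fun s = lcs_fun T t.
  have : C0 (lcs_fun T t : X -> R) by rewrite -(lcs_fun_range T); exists t.
  by rewrite -weighted_fun_range => -[s _ st]; exists s.
have cid := Tfine weighted_topology weighted_continuous_inclusions id idP.
have [t0 _ t0phi] : range (lcs_fun T) phi by rewrite lcs_fun_range.
pose B := [set s : weighted w | `|id t0 - s| < e].
have oB : open B.
  by have := @ball_open R (weighted w) (id t0) e; rewrite -ball_normE.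
have [|t [Bt Dt]] := dD (id @^-1` B) _ (open_comp (fun x _ => cid x) oB).
  by exists t0; rewrite /B /= subrr normr0.
exists (lcs_fun T t) => // x; rewrite -t0phi -!idP.
have := wnorm_ge (id t0 - id t) x; rewrite raddfB distrC.
move/le_trans; apply; rewrite ler_wpM2r//; first by rewrite ltW// weight_gt0.
exact: ltW.
Qed.

End norm.

End weighted_norm.

(* Locked because [ring] and [lra] compare atoms up to conversion, which would
   unfold the integrals. *)
HB.lock Definition inner {R : realType} {X : ptopologicalType}
  (kappa : X -> X -> \bar R) (mu nu : borel_measure X R) : R :=
  fine (mutual_energy kappa mu nu).

(** * Radon measures on a second-countable locally compact Hausdorff space *)

Section lch_space.
Context {R : realType} {X : ptopologicalType}.
Hypotheses (hX : hausdorff_space X) (lcX : locally_compact [set: X]).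
Hypothesis scX : second_countable (T := X).
Implicit Types mu nu lam theta : borel_measure X R.

Lemma lindelof (D : set X) (O : X -> set X) :
  (forall x, D x -> open (O x) /\ O x x) ->
  exists u : nat -> X, D `<=` \bigcup_(n in [set n | D (u n)]) O (u n).
Proof.
move=> DO; have [B cB [oB Bnbhs]] := scX.
have /pcard_surjP[g gB] := cB.
(* For a basic set that fits no [O x] the value is the default [point], possibly outside [D]; hence
   the restriction of the union to the [n] with [D (u n)]. *)
exists (fun n => xget point [set x | D x /\ g n `<=` O x]) => x Dx.
have [oOx Oxx] := DO x Dx.
have [V [BV Vx] VO] : exists2 V, B V /\ V x & V `<=` O x.
  by have /(_ (O x) (open_nbhs_nbhs (conj oOx Oxx)))[V] := Bnbhs x; exists V.
have [n _ gnV] := gB V BV.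
have : [set x | D x /\ g n `<=` O x] x by split => //; rewrite gnV.
move=> /(xgetI point)[Dn gn].
by exists n => //; apply: gn; rewrite gnV.
Qed.

Lemma compact_nbhs_in (x : X) (U : set X) : open U -> U x ->
  exists V, [/\ open V, V x, compact (closure V) & closure V `<=` U].
Proof.
move=> oU Ux.
have [K nK [cK clK]] := @lcX x I.
have {}nK : nbhs x K by move: nK; rewrite /within/=; apply: filterS => y; apply.
have reg := compact_regular hX cK nK.
have nUK : nbhs x (U `&` K) by apply: filterI => //; exact: open_nbhs_nbhs.
have [V nV VUK] := reg _ nUK.
exists V^°; split.
- exact: open_interior.
- exact: nV.
- apply: (subclosed_compact _ cK); first exact: closed_closure.
  by apply: subset_trans (closure_subset (@interior_subset _ V)) _ => y /VUK[].
- by apply: subset_trans (closure_subset (@interior_subset _ V)) _ => y /VUK[].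
Qed.

(** Complete regularity gives [f] vanishing at [x] and equal to 1 off a relatively compact
    neighbourhood [V]; then [1 - f] is supported in the closure of [V]. *)
Lemma bump (x : X) (U : set X) : open U -> U x ->
  exists phi : X -> R, [/\ C0 phi, forall y, 0 <= phi y, phi x = 1 &
    supp phi `<=` U].
Proof.
move=> oU Ux; have [V [oV Vx cV VU]] := compact_nbhs_in oU Ux.
have crX : completely_regular_space X.
  exact: (@locally_compact_completely_regular _ R).
have /(@uniform_separatorP X R)[f [cf f01 f0 f1]] :=
  crX x _ (open_closedC oV) (fun nVx => nVx Vx).
have sV : supp (fun y => 1 - f y) `<=` closure V.
  apply: closure_subset => y /= fy; apply: contrapT => nVy.
  by move: fy; rewrite (f1 (f y)) ?subrr ?eqxx//; exists y.
exists (fun y => 1 - f y); split.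
- split; last first.
    by apply: (subclosed_compact _ _ sV) => //; exact: closed_closure.
  by move=> y; apply: cvgB; [exact: cvg_cst|exact: cf].
- move=> y; have : `[0%R, 1%R]%classic (f y) by apply: f01; exists y.
  by rewrite /= in_itv/= subr_ge0 => /andP[].
- by rewrite (f0 (f x)) ?subr0//; exists x.
- exact: subset_trans sV VU.
Qed.

Lemma open_sigma_compact (U : set X) : open U ->
  exists K : nat -> set X, (forall n, compact (K n)) /\ U = \bigcup_n K n.
Proof.
move=> oU.
pose O x := xget set0 [set V | [/\ open V, V x, compact (closure V) &
  closure V `<=` U]].
have OP x : U x -> [/\ open (O x), O x x, compact (closure (O x)) &
  closure (O x) `<=` U].
  move=> Ux; have [V VP] := compact_nbhs_in oU Ux.
  by rewrite /O; case: xgetP => [V' _ //|/(_ V)].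
have [u uP] := @lindelof U O (fun x Ux => let: And4 a b _ _ := OP x Ux in conj a b).
exists (fun n => if pselect (U (u n)) then closure (O (u n)) else set0); split.
  by move=> n; case: pselect => /= [/OP[]//|_]; exact: compact0.
apply/seteqP; split => x.
  move=> /uP[n Un Ox]; exists n => //; case: pselect => /= // _.
  exact: subset_closure.
by move=> [n _]; case: pselect => /= // Un; have [_ _ _] := OP _ Un; apply.
Qed.

Lemma borel_open (U : set X) : open U -> measurable (U : set (borel X)).
Proof. exact: sub_sigma_algebra. Qed.

Lemma borel_closed (F : set X) : closed F -> measurable (F : set (borel X)).
Proof.
by move=> cF; rewrite -[F]setCK; apply: measurableC; apply: borel_open; exact: closed_openC.
Qed.

Lemma borel_compact (K : set X) : compact K -> measurable (K : set (borel X)).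
Proof. by move=> cK; apply: borel_closed; exact: compact_closed. Qed.

Lemma lsc_measurable d (T : measurableType d) (f : T -> \bar R) :
  (forall a : R, measurable [set x | (a%:E < f x)%E]) -> measurable_fun setT f.
Proof.
move=> mf; apply: (measurability _ (ErealGenOInfty.measurableE R)) => _ [_ [a ->] <-].
rewrite setTI [X in measurable X](_ : _ = [set x | (a%:E < f x)%E]) //.
by apply/seteqP; split => x /=; rewrite in_itv/= ?andbT.
Qed.

Lemma continuous_borel (phi : X -> R) : continuous phi ->
  measurable_fun [set: borel X] phi.
Proof.
move=> cphi; apply/measurable_EFinP/lsc_measurable => a /=.
rewrite (_ : [set _ | _] = phi @^-1` [set y | a < y]).
  by apply: borel_open; have /continuousP := cphi; apply; exact: open_gt.
by apply/seteqP; split => x /=; rewrite lte_fin.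
Qed.

(** By second countability an open set is a countable union of open rectangles. This puts it in the
    product of the Borel sigma-algebras, on which [mu \x nu] lives, and makes the lower
    semicontinuous kernel measurable there. *)
Lemma open_prod_measurable (U : set (X * X)) : open U ->
  measurable (U : set (borel X * borel X)).
Proof.
move=> oU; have [B cB [oB Bnbhs]] := scX.
have /pcard_surjP[g gB] := cB.
pose W n m := if pselect [/\ open (g n), open (g m) & g n `*` g m `<=` U]
  then g n `*` g m else set0.
have -> : U = \bigcup_n \bigcup_m W n m.
  apply/seteqP; split => [[x y] Uxy|[x y] [n _ [m _]]]; last first.
    by rewrite /W; case: pselect => /= // -[_ _ sU] h; exact: (sU (x, y) h).
  have [[P Q] /= [nP nQ] PQU] : nbhs (x, y) U by exact: open_nbhs_nbhs.
  have [V [BV Vx] VP] := Bnbhs x P nP.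
  have [V' [BV' Vy] VQ] := Bnbhs y Q nQ.
  have [n _ gn] := gB V BV; have [m _ gm] := gB V' BV'.
  exists n => //; exists m => //; rewrite /W gn gm; case: pselect => //.
  case; split; [exact: oB|exact: oB|].
  by move=> [a b] /= [/VP ? /VQ ?]; exact: (PQU (a, b)).
apply: bigcup_measurable => n _; apply: bigcup_measurable => m _.
rewrite /W; case: pselect => /= // -[on om _].
by apply: measurableX; exact: borel_open.
Qed.

Lemma sigma_compact : exists L : nat -> set X,
  [/\ forall n, compact (L n), nondecreasing_seq L & \bigcup_n L n = setT].
Proof.
have [K [cK KT]] := open_sigma_compact openT.
exists (fun n => \big[setU/set0]_(i < n.+1) K i); split.
- by move=> n; apply: bigsetU_compact.
- by move=> m n mn; apply/subsetPset; apply: subset_bigsetU.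
- rewrite KT; apply/seteqP; split => x [n _].
    by rewrite -bigcup_mkord => -[i _ Kx]; exists i.
  by move=> Kx; exists n => //; rewrite -bigcup_mkord; exists n => /=.
Qed.

(** * Regularity of Borel measures *)

Section regularity.
Local Open Scope ereal_scope.

(** Approximation is from inside by closed sets and from outside by open sets at once, which makes
    the property stable under complements. *)
Definition squeezed (mu : borel_measure X R) (B : set X) :=
  measurable (B : set (borel X)) /\
  forall e : R, (0 < e)%R -> exists F O, [/\ closed F, open O, F `<=` B,
    B `<=` O & mu (O `\` F) <= e%:E].

Lemma finite_tail (mu : borel_measure X R) (F : nat -> set X) (e : R) :
  mu setT < +oo -> (forall n, measurable (F n : set (borel X))) -> (0 < e)%R ->
  exists n, mu ((\bigcup_i F i) `\` \big[setU/set0]_(i < n) F i) <= e%:E.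
Proof.
move=> fmu mF e0.
pose D n : set (borel X) := (\bigcup_i F i) `\` \big[setU/set0]_(i < n) F i.
have mD n : measurable (D n).
  by apply: measurableD; [exact: bigcup_measurable|exact: bigsetU_measurable].
have D0 : \bigcap_n D n = set0.
  apply/seteqP; split => // x Dx.
  have [[i _ Fx] _] := Dx 0%N I; have [_] := Dx i.+1 I; apply.
  by rewrite -bigcup_mkord; exists i => /=.
have : (mu \o D) n @[n --> \oo] --> mu (\bigcap_n D n).
  apply: nonincreasing_cvg_mu => //.
  - by apply: le_lt_trans fmu; apply: le_measure; rewrite ?inE.
  - by rewrite D0.
  - move=> m n mn; apply/subsetPset => x [Fx nFx]; split => //.
    by apply: contra_not nFx; apply: subset_bigsetU.
rewrite D0 measure0 => /fine_cvgP[fin].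
move=> /cvgrPdist_le/(_ e e0) H.
near \oo => n; exists n.
have finn : mu (D n) \is a fin_num by near: n.
rewrite -/(D n) -(fineK finn) lee_fin.
have : (`|0 - fine (mu (D n))| <= e)%R by near: n.
by rewrite sub0r normrN ger0_norm ?fine_ge0.
Unshelve. all: by end_near. Qed.

Lemma squeezed_open (mu : borel_measure X R) (U : set X) :
  mu setT < +oo -> open U -> squeezed mu U.
Proof.
move=> fmu oU; split; first exact: borel_open.
move=> e e0; have [K [cK UK]] := open_sigma_compact oU.
have [n ne] := finite_tail fmu (fun n => borel_compact (cK n)) e0.
exists (\big[setU/set0]_(i < n) K i), U; split => //.
- by apply: compact_closed => //; exact: bigsetU_compact.
- by rewrite UK -bigcup_mkord; apply: bigcup_sub => i _; exact: bigcup_sup.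
- by rewrite {1}UK.
Qed.

Lemma squeezedC (mu : borel_measure X R) (B : set X) :
  squeezed mu B -> squeezed mu (~` B).
Proof.
move=> [mB h]; split; first exact: measurableC.
move=> e e0; have [F [V [cF oV FB BV mFV]]] := h e e0; exists (~` V), (~` F); split.
- exact: open_closedC.
- exact: closed_openC.
- exact: subsetC.
- exact: subsetC.
- by rewrite setDE setCK setIC.
Qed.

(** An infinite union of closed sets need not be closed. Half of [e] pays for approximating the
    single sets, the other half for cutting the union of the closed sets at a finite stage. *)
Lemma squeezed_bigcup (mu : borel_measure X R) (B : nat -> set X) :
  mu setT < +oo -> (forall n, squeezed mu (B n)) -> squeezed mu (\bigcup_n B n).
Proof.
move=> fmu sB; split; first by apply: bigcup_measurable => n _; case: (sB n).
move=> e e0.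
have /choice[FO FOP] n : exists FO : set X * set X,
    [/\ closed FO.1, open FO.2, FO.1 `<=` B n, B n `<=` FO.2 &
        mu (FO.2 `\` FO.1) <= (e / 2 / (2 ^ n.+1)%:R)%:E].
  have [|F [V H]] := (sB n).2 (e / 2 / (2 ^ n.+1)%:R)%R; last by exists (F, V).
  by rewrite !divr_gt0// ltr0n expn_gt0.
pose F n := (FO n).1; pose O n := (FO n).2.
have cF n : closed (F n) by case: (FOP n).
have mF n : measurable (F n : set (borel X)) by exact: borel_closed.
have mO n : measurable (O n : set (borel X)).
  by apply: borel_open; case: (FOP n).
have [n ne] := finite_tail fmu mF (divr_gt0 e0 (ltr0Sn R 1)).
exists (\big[setU/set0]_(i < n) F i), (\bigcup_i O i); split.
- by rewrite -bigcup_mkord; apply: closed_bigcup => // i _.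
- by apply: bigcup_open => i _; case: (FOP i).
- rewrite -bigcup_mkord => x [i _ Fx]; exists i => //.
  by case: (FOP i) => _ _ FB _ _; exact: FB.
- by apply: subset_bigcup => i _; case: (FOP i).
have mU : measurable (\bigcup_i F i : set (borel X)) by exact: bigcup_measurable.
have mUn : measurable (\big[setU/set0]_(i < n) F i : set (borel X)).
  exact: bigsetU_measurable.
have mV : measurable (\bigcup_i O i : set (borel X)) by exact: bigcup_measurable.
have mOF i : measurable (O i `\` F i : set (borel X)) by exact: measurableD.
have sub : (\bigcup_i O i) `\` \big[setU/set0]_(i < n) F i `<=`
    (\bigcup_i (O i `\` F i)) `|` ((\bigcup_i F i) `\` \big[setU/set0]_(i < n) F i).
  move=> x [[i _ Ox] nF]; have [Fx|nFx] := pselect (F i x).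
    by right; split => //; exists i.
  by left; exists i.
apply: (@le_trans _ _ (mu (\bigcup_i (O i `\` F i)) +
   mu ((\bigcup_i F i) `\` \big[setU/set0]_(i < n) F i))).
  have mOFU : measurable (\bigcup_i (O i `\` F i) : set (borel X)).
    exact: bigcup_measurable.
  have mFF : measurable ((\bigcup_i F i) `\` \big[setU/set0]_(i < n) F i : set (borel X)).
    exact: measurableD.
  apply: le_trans (measureU2 _ mOFU mFF).
  by apply: le_measure => //; rewrite inE; [exact: measurableD|exact: measurableU].
rewrite [leRHS](_ : _ = (e / 2)%:E + (e / 2)%:E); last first.
  by rewrite -EFinD -splitr.
apply: leeD => //.
apply: (@le_trans _ _ (\sum_(0 <= i <oo) mu (O i `\` F i))).
  by apply: measure_sigma_subadditive => //; exact: bigcup_measurable.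
apply: (@le_trans _ _ (\sum_(0 <= i <oo) (e / 2 / (2 ^ i.+1)%:R)%:E)).
  by apply: lee_nneseries => // i _; case: (FOP i).
by apply: epsilon_trick0; rewrite divr_ge0// ltW.
Qed.

Lemma finite_regular (mu : borel_measure X R) (B : set (borel X)) :
  mu setT < +oo -> measurable B -> squeezed mu B.
Proof.
move=> fmu; have : <<s @open X >> `<=` squeezed mu.
  apply: smallest_sub; last by move=> U; exact: squeezed_open.
  split; first exact: (squeezed_open fmu open0).
    by move=> A sA; rewrite setTD; exact: squeezedC.
  by move=> A sA; exact: squeezed_bigcup.
exact.
Qed.

(** On each compact [L j] the measure is finite, hence regular. The closed sets [F (j, k)], cut down
    to [L j], exhaust [B] up to a null set, and finite unions along an enumeration of the pairs make
    the sequence increasing. *)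
Lemma radon_regular (mu : borel_measure X R) (B : set (borel X)) :
  Mplus mu -> measurable B -> exists C : nat -> set X,
  [/\ forall n, compact (C n), nondecreasing_seq C, forall n, C n `<=` B &
      mu (B `\` \bigcup_n C n) = 0].
Proof.
move=> Mmu mB; have [L [cL ndL LT]] := sigma_compact.
have mL j := borel_compact (cL j).
have /choice[F FP] jk : exists F : set X, [/\ closed F, F `<=` B &
    mu ((B `\` F) `&` L jk.1) <= ((jk.2 : nat).+1%:R^-1)%:E].
  have fj : mrestr mu (mL jk.1) setT < +oo.
    by rewrite /mrestr setTI; exact: Mmu.
  have [_ /(_ (jk.2.+1%:R^-1)%R)[|F [V [cF oV FB BV mVF]]]] := finite_regular fj mB.
    by rewrite invr_gt0.
  exists F; split => //; apply: le_trans mVF.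
  apply: le_measure; rewrite ?inE.
  - apply: measurableI => //; apply: measurableD => //; exact: borel_closed.
  - apply: measurableI => //; apply: measurableD; [exact: borel_open|exact: borel_closed].
  - by apply: setSI; exact: setSD.
have cFL jk : compact (F jk `&` L jk.1).
  apply: (@subclosed_compact _ _ (L jk.1)) => //.
  apply: closedI; [by case: (FP jk)|exact: compact_closed].
have [g gs] : exists g : nat -> nat * nat, set_surj setT setT g.
  have /pcard_surjP[g gs] : countable [set: nat * nat] by exact: countableP.
  by exists g.
pose K i := F (g i) `&` L (g i).1.
exists (fun n => \big[setU/set0]_(i < n) K i); split.
- by move=> n; apply: bigsetU_compact => i _; exact: cFL.
- by move=> m n mn; apply/subsetPset; exact: subset_bigsetU.
- move=> n /=; rewrite -bigcup_mkord => x [i _ [Fx _]].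
  by case: (FP (g i)) => _ + _; apply.
set C := \bigcup_n _.
have FLC jk : F jk `&` L jk.1 `<=` C.
  have [i _ gi] := gs jk I; move=> x Fx; exists i.+1 => //.
  by rewrite -bigcup_mkord; exists i => //=; rewrite /K gi.
have mC : measurable (C : set (borel X)).
  apply: bigcup_measurable => n _; apply: bigsetU_measurable => i _.
  by apply: borel_compact => //; exact: cFL.
have null j : mu ((B `\` C) `&` L j) = 0.
  apply/eqP; rewrite eq_le measure_ge0 andbT; apply/lee_addgt0Pr => e e0.
  rewrite add0e.
  have [k ke] : exists k : nat, (k.+1%:R^-1 < e)%R.
    by have [k _ /(_ k (leqnn k))] := near_infty_natSinv_lt (PosNum e0); exists k.

  apply: (@le_trans _ _ (mu ((B `\` F (j, k)) `&` L j))); last first.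
    by case: (FP (j, k)) => _ _ /= /le_trans; apply; rewrite lee_fin ltW.
  apply: le_measure; rewrite ?inE.
  - by apply: measurableI => //; exact: measurableD.
  - apply: measurableI => //; apply: measurableD => //.
    by apply: borel_closed; case: (FP (j, k)).
  - move=> x [[Bx nCx] Lx]; split => //; split => // Fx; apply: nCx.
    by apply: (FLC (j, k)).
have -> : B `\` C = \bigcup_j ((B `\` C) `&` L j).
  by rewrite -setI_bigcupr LT setIT.
apply/negligibleP; first by apply: bigcup_measurable => j _;
  apply: measurableI => //; exact: measurableD.
apply: negligible_bigcup => j; exists ((B `\` C) `&` L j); split => //.
by apply: measurableI => //; exact: measurableD.
Qed.

End regularity.

(** * Operations on positive Radon measures *)

Section radon_cone.
Local Open Scope ereal_scope.

Lemma Mplus_add mu nu : Mplus mu -> Mplus nu -> Mplus (measure_add mu nu).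
Proof.
by move=> hm hn K cK; rewrite [ltLHS]measure_addE lte_add_pinfty ?hm ?hn.
Qed.

Lemma Mplus_scale (c : {nonneg R}) mu : Mplus mu -> Mplus (mscale c mu).
Proof. by move=> hm K cK; rewrite /= /mscale lte_mul_pinfty ?lee_fin// hm. Qed.

Lemma Mplus_le mu nu : Mplus mu ->
  (forall B : set (borel X), measurable B -> nu B <= mu B) -> Mplus nu.
Proof.
move=> hm numu K cK; apply: le_lt_trans (hm K cK).
by apply: numu; exact: borel_compact.
Qed.

Lemma Mplus_restr mu (D : set (borel X)) (mD : measurable D) :
  Mplus mu -> Mplus (mrestr mu mD).
Proof.
move=> hm; apply: (Mplus_le hm) => B mB; rewrite /= /mrestr.
by apply: le_measure; rewrite ?inE//; exact: measurableI.
Qed.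

Lemma Mplus0 : Mplus (mzero : borel_measure X R).
Proof. by move=> K _; rewrite /= /mzero. Qed.

(** One partition serves all Radon measures at once, as is needed to decompose a difference of two
    of them. *)
Lemma radon_partition : exists F : nat -> set (borel X),
  [/\ forall i, measurable (F i), trivIset setT F, \bigcup_i F i = setT &
      forall mu, Mplus mu -> forall i, mu (F i) < +oo].
Proof.
have [L [cL ndL LT]] := sigma_compact.
have mL i := borel_compact (cL i).
have mF i : measurable (seqD L i : set (borel X)).
  by case: i => [|i]; rewrite /seqD//; exact: measurableD.
exists (seqD L); split => //.
- exact: trivIset_seqD.
- by rewrite eq_bigcup_seqD.
- move=> mu hm i; apply: le_lt_trans (hm _ (cL i)).
  apply: le_measure; rewrite ?inE//.
  by case: i => [|i] //; exact: subDsetl.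
Qed.

(** A copy of [mu] indexed by a proof of sigma-finiteness, to which the structure required by the
    Fubini-Tonelli theorem can be attached. *)
Definition with_sigma_finite mu (_ : sigma_finite setT mu) :
  set (borel X) -> \bar R := mu.

HB.instance Definition _ mu (s : sigma_finite setT mu) :=
  Measure.copy (with_sigma_finite s) mu.

HB.instance Definition _ mu (s : sigma_finite setT mu) :=
  @Measure_isSigmaFinite.Build _ _ _ (with_sigma_finite s) s.

Lemma radon_sigma_finite mu : Mplus mu ->
  exists m : {sigma_finite_measure set (borel X) -> \bar R},
    (m : set (borel X) -> \bar R) = mu.
Proof.
move=> hm; have [F [mF _ FT Ffin]] := radon_partition.
have sf : sigma_finite setT mu.
  by exists F; rewrite ?FT// => i; split; [exact: mF|exact: Ffin].
by exists (with_sigma_finite sf).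
Qed.

End radon_cone.

Lemma C0_integrable mu (phi : X -> R) : Mplus mu -> C0 phi ->
  mu.-integrable setT (fun x : borel X => (phi x)%:E).
Proof.
move=> hmu hphi; have [cphi cs] := hphi; have [M M0 hM] := C0_bounded hphi.
have ms := borel_compact cs.
have mphi : measurable_fun [set: borel X] (fun x : borel X => (phi x)%:E).
  by apply/measurable_EFinP; exact: continuous_borel.
apply/integrableP; split => //.
apply: (@le_lt_trans _ _ (\int[mu]_x (M%:E * (\1_(supp phi) x)%:E))%E).
  apply: ge0_le_integral => //.
  - exact: measurableT_comp.

  - apply: measurable_funeM; apply/measurable_EFinP; exact: measurable_indic.
  - move=> x _; rewrite abse_EFin lee_fin indicE.
    have [xs|xs] := boolP (x \in supp phi); first by rewrite mulr1.
    have [->|phix] := eqVneq (phi x) 0; first by rewrite normr0 mulr0.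
    move: xs; rewrite notin_setE => -[]; exact: subset_closure.
rewrite ge0_integralZl//; last first.
  by apply/measurable_EFinP; exact: measurable_indic.
rewrite integral_indic// setIT lte_mul_pinfty ?lee_fin//.
exact: hmu.
Qed.

(** * Energies and potentials *)

Variable kappa : X -> X -> \bar R.
Hypothesis hk : is_kernel kappa.

Section energy.
Local Open Scope ereal_scope.

Let k0 x y : 0 <= kappa x y. Proof. by case: hk. Qed.
Let kC x y : kappa x y = kappa y x. Proof. by case: hk. Qed.

Lemma kernel_measurable :
  measurable_fun [set: borel X * borel X] (fun p : borel X * borel X => kappa p.1 p.2).
Proof.
apply: lsc_measurable => a; apply: open_prod_measurable => //.
by case: hk => _ _ /lower_semicontinuousP; apply.
Qed.

Lemma potential_ge0 mu x : 0 <= potential kappa mu x.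
Proof. by apply: integral_ge0. Qed.

Lemma potential_measurable mu : Mplus mu ->
  measurable_fun [set: borel X] (potential kappa mu).
Proof.
move=> /(radon_sigma_finite)[m mE].
have -> : potential kappa mu = fubini_F m (fun p : borel X * borel X => kappa p.1 p.2).
  by apply/funext => x; rewrite /potential /fubini_F -mE.
by apply: measurable_fun_fubini_tonelli_F => //; exact: kernel_measurable.
Qed.

Lemma mutual_energyE mu nu : Mplus mu -> Mplus nu ->
  mutual_energy kappa mu nu = \int[mu]_x potential kappa nu x.
Proof.
move=> /(radon_sigma_finite)[m mE] /(radon_sigma_finite)[n nE].
rewrite /mutual_energy /potential -mE -nE fubini_tonelli1//.
exact: kernel_measurable.
Qed.

Lemma mutual_energy_ge0 mu nu : Mplus mu -> Mplus nu ->
  0 <= mutual_energy kappa mu nu.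
Proof.
move=> hmu hnu; rewrite mutual_energyE//.
by apply: integral_ge0 => x _; exact: potential_ge0.
Qed.

Lemma mutual_energyC mu nu : Mplus mu -> Mplus nu ->
  mutual_energy kappa mu nu = mutual_energy kappa nu mu.
Proof.
move=> hmu hnu; rewrite !mutual_energyE//; move: hmu hnu.
move=> /(radon_sigma_finite)[m mE] /(radon_sigma_finite)[n nE].
rewrite /potential -mE -nE.
have F := @fubini_tonelli _ _ _ _ _ m n _ kernel_measurable (fun p => k0 p.1 p.2).
apply: (etrans F).
by apply: eq_integral => y _; apply: eq_integral => x _; exact: kC.
Qed.

Lemma mutual_energyDl mu1 mu2 nu : Mplus mu1 -> Mplus mu2 -> Mplus nu ->
  mutual_energy kappa (measure_add mu1 mu2) nu =
  mutual_energy kappa mu1 nu + mutual_energy kappa mu2 nu.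
Proof.
move=> h1 h2 hnu; rewrite !mutual_energyE//; last exact: Mplus_add.
rewrite ge0_integral_measure_add//; first by move=> *; exact: potential_ge0.
exact: potential_measurable.
Qed.

Lemma mutual_energyZl (c : {nonneg R}) mu nu : Mplus mu -> Mplus nu ->
  mutual_energy kappa (mscale c mu) nu = c%:num%:E * mutual_energy kappa mu nu.
Proof.
move=> h1 hnu; rewrite !mutual_energyE//; last exact: Mplus_scale.
rewrite ge0_integral_mscale//; last by move=> *; exact: potential_ge0.
exact: potential_measurable.
Qed.

Lemma mutual_energyDr mu1 mu2 nu : Mplus mu1 -> Mplus mu2 -> Mplus nu ->
  mutual_energy kappa nu (measure_add mu1 mu2) =
  mutual_energy kappa nu mu1 + mutual_energy kappa nu mu2.
Proof.
move=> h1 h2 hnu; rewrite mutual_energyC ?mutual_energyDl//; last exact: Mplus_add.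
by rewrite !(mutual_energyC _ hnu).
Qed.

Lemma mutual_energyZr (c : {nonneg R}) mu nu : Mplus mu -> Mplus nu ->
  mutual_energy kappa nu (mscale c mu) = c%:num%:E * mutual_energy kappa nu mu.
Proof.
move=> h1 hnu; rewrite mutual_energyC ?mutual_energyZl//; last exact: Mplus_scale.
by rewrite !(mutual_energyC _ hnu).
Qed.

Lemma same_mutual_energyl mu mu' nu : same_measure mu mu' -> Mplus mu ->
  Mplus nu -> mutual_energy kappa mu nu = mutual_energy kappa mu' nu.
Proof.
move=> mm hmu hnu; rewrite !mutual_energyE//; last first.
  by apply: (Mplus_le hmu) => B mB; rewrite mm.
by apply: eq_measure_integral => A mA _; exact: mm.
Qed.

Lemma same_measure_Mplus mu mu' : same_measure mu mu' -> Mplus mu -> Mplus mu'.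
Proof. by move=> mm hmu; apply: (Mplus_le hmu) => B mB; rewrite mm. Qed.

Lemma same_mutual_energy mu mu' nu nu' : same_measure mu mu' ->
  same_measure nu nu' -> Mplus mu -> Mplus nu ->
  mutual_energy kappa mu nu = mutual_energy kappa mu' nu'.
Proof.
move=> mm nn hmu hnu; have hmu' := same_measure_Mplus mm hmu.
have hnu' := same_measure_Mplus nn hnu.
rewrite (same_mutual_energyl mm hmu hnu) (mutual_energyC hmu' hnu).
by rewrite (same_mutual_energyl nn hnu hmu') (mutual_energyC hnu' hmu').
Qed.

Lemma mutual_energy_restr_le mu nu (D : set (borel X)) (mD : measurable D) :
  Mplus mu -> Mplus nu ->
  mutual_energy kappa (mrestr mu mD) nu <= mutual_energy kappa mu nu.
Proof.
move=> hmu hnu.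
have mDC := measurableC mD.
have -> : mutual_energy kappa mu nu =
  mutual_energy kappa (measure_add (mrestr mu mD) (mrestr mu mDC)) nu.
  apply: same_mutual_energyl => // B mB.
  rewrite [RHS]measure_addE /= /mrestr -measureU//.
  - by rewrite -setIUr setUv setIT.
  - exact: measurableI.
  - exact: measurableI.
  - by rewrite setIACA setICr setI0.
rewrite mutual_energyDl//; try exact: Mplus_restr.
by rewrite leeDl// mutual_energy_ge0//; exact: Mplus_restr.
Qed.

Lemma energy_restr_le mu (D : set (borel X)) (mD : measurable D) : Mplus mu ->
  energy kappa (mrestr mu mD) <= energy kappa mu.
Proof.
move=> hmu; rewrite /energy.
apply: le_trans (mutual_energy_restr_le mD hmu hmu).
rewrite [leRHS]mutual_energyC//; last exact: Mplus_restr.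
by apply: mutual_energy_restr_le => //; exact: Mplus_restr.
Qed.

End energy.

(** * The energy inner product *)

Local Notation I := (mutual_energy kappa).
Local Notation U := (potential kappa).
Local Notation E := (Eplus kappa).
Local Notation inner := (inner kappa).
Local Notation dist := (strong_dist kappa).

Hypothesis hen : energy_principle kappa.

Lemma radon_jordan mu nu : Mplus mu -> Mplus nu ->
  exists s1 s2 m : borel_measure X R, [/\ signed_Radon (s1, s2), Mplus m,
    same_measure mu (measure_add s1 m) & same_measure nu (measure_add s2 m)].
Proof.
move=> hmu hnu; have [F [mF tF FT Ffin]] := radon_partition.
have [s1 [s2 [m [P [mP mus1 nus2 s1P s2P]]]]] :=
  sigma_finite_jordan mF tF FT (Ffin _ hmu) (Ffin _ hnu).
exists s1, s2, m; split.
- split => /=; last by exists P.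
  + by apply: (Mplus_le hmu) => B mB; rewrite mus1// leeDl.
  + by apply: (Mplus_le hnu) => B mB; rewrite nus2// leeDl.
- by apply: (Mplus_le hmu) => B mB; rewrite mus1// leeDr.
- by move=> B mB; rewrite [RHS]measure_addE mus1.
- by move=> B mB; rewrite [RHS]measure_addE nus2.
Qed.

(* The measures [mu] and [nu] need not be mutually singular: the energy principle
   is applied to [(s1, s2)], where [mu = s1 + m] and [nu = s2 + m]. *)
Lemma energy_difference mu nu : E mu -> E nu ->
  [/\ (I mu nu < +oo)%E,
      0 <= inner mu mu - 2 * inner mu nu + inner nu nu &
      inner mu mu - 2 * inner mu nu + inner nu nu = 0 -> same_measure mu nu].
Proof.
move=> [hmu emu] [hnu enu].
have [s1 [s2 [m [sR hm mus nus]]]] := radon_jordan hmu hnu.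
have [h1 h2 _] := sR; rewrite /= in h1 h2.
have h1m : Mplus (measure_add s1 m) by exact: Mplus_add.
have h2m : Mplus (measure_add s2 m) by exact: Mplus_add.
have Ds (s t : borel_measure X R) : Mplus s -> Mplus t ->
    I (measure_add s m) (measure_add t m) = (I s t + I s m + (I t m + I m m))%E.
  move=> hs ht; have htm : Mplus (measure_add t m) by exact: Mplus_add.
  rewrite (mutual_energyDl hs hm htm).
  rewrite (mutual_energyDr ht hm hs).
  rewrite (mutual_energyDr ht hm hm).
  by rewrite (mutual_energyC hm ht).
move: emu enu; rewrite /energy inner.unlock.
rewrite (same_mutual_energy mus mus hmu hmu).
rewrite (same_mutual_energy nus nus hnu hnu).
rewrite (same_mutual_energy mus nus hmu hnu).
rewrite (Ds s1 s1 h1 h1) (Ds s1 s2 h1 h2) (Ds s2 s2 h2 h2).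
have := hen sR; rewrite /signed_energy_defined /signed_energy.
rewrite /mutual_energy_pos /mutual_energy_neg /zero_signed /=.
rewrite (mutual_energyC h2 h1).
have := mutual_energy_ge0 h1 h1.
have := mutual_energy_ge0 h2 h2.
have := mutual_energy_ge0 h1 h2.
have := mutual_energy_ge0 h1 hm.
have := mutual_energy_ge0 h2 hm.
have := mutual_energy_ge0 hm hm.
have same : zero_measure s1 /\ zero_measure s2 -> same_measure mu nu.
  move=> [z1 z2] B mB; rewrite mus// nus//.
  by rewrite [LHS]measure_addE [RHS]measure_addE z1// z2.
move: same; rewrite /same_measure.
move: (I s1 s1) (I s2 s2) (I s1 s2) (I s1 m) (I s2 m) (I m m).
move=> a b c d f g same.
(* Finiteness of the energies of [mu] and [nu] leaves only [c], the mutual energy of [s1] and [s2],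
   possibly infinite; the signed energy would then be [-oo], against the energy principle. *)
case: a => [a| |]// ; case: b => [b| |]//; case: d => [d| |]//;
  case: f => [f| |]//; case: g => [g| |]//;
  case: c => [c| |]//; move=> _ _ _ _ _ _ h e1 e2;
  have {h}[|h hz] := h; rewrite -?EFinD ?ltry//; try by left.
rewrite -!EFinB/= in h hz *; rewrite lee_fin in h; split.
- by [].
- by move: h; congr (0 <= _); ring.
- move=> q0; apply: same; apply: hz; congr (_%:E); rewrite -[RHS]q0; ring.
Qed.

Lemma inner_fin mu nu : E mu -> E nu -> I mu nu = (inner mu nu)%:E.
Proof.
move=> hmu hnu; have [lty _ _] := energy_difference hmu hnu.
rewrite inner.unlock fineK// ge0_fin_numE//.
by apply: mutual_energy_ge0; [case: hmu|case: hnu].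
Qed.

Lemma Eplus_add mu nu : E mu -> E nu -> E (measure_add mu nu).
Proof.
move=> hmu hnu; have [hm _] := hmu; have [hn _] := hnu.
have hmn : Mplus (measure_add mu nu) by exact: Mplus_add.
split => //; rewrite /energy.
rewrite (mutual_energyDl hm hn hmn).
rewrite (mutual_energyDr hm hn hm).
rewrite (mutual_energyDr hm hn hn).
by rewrite (inner_fin hmu hmu) (inner_fin hmu hnu) (inner_fin hnu hmu)
  (inner_fin hnu hnu) -!EFinD ltry.
Qed.

Lemma Eplus_scale (c : {nonneg R}) mu : E mu -> E (mscale c mu).
Proof.
move=> hmu; have [hm _] := hmu.
have hcm : Mplus (mscale c mu) by exact: Mplus_scale.
split => //; rewrite /energy.
rewrite (mutual_energyZl c hm hcm).
rewrite (mutual_energyZr c hm hm).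
by rewrite (inner_fin hmu hmu) -!EFinM ltry.
Qed.

Lemma Eplus_restr mu (D : set (borel X)) (mD : measurable D) :
  E mu -> E (mrestr mu mD).
Proof.
move=> [hm em]; split; first exact: Mplus_restr.
by apply: le_lt_trans em; exact: energy_restr_le.
Qed.

Lemma mutual_energy0 mu : Mplus mu -> I mzero mu = 0%E.
Proof.
move=> hm; rewrite (mutual_energyE _ hm); last exact: Mplus0.
exact: integral_measure_zero.
Qed.

Lemma Eplus0 : E mzero.
Proof.
have h0 := Mplus0; split => //.
by rewrite /energy (mutual_energy0 h0).
Qed.

Lemma innerC mu nu : E mu -> E nu -> inner mu nu = inner nu mu.
Proof.
by move=> [hm _] [hn _]; rewrite inner.unlock (mutual_energyC hm hn).
Qed.

Lemma innerDl mu1 mu2 nu : E mu1 -> E mu2 -> E nu ->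
  inner (measure_add mu1 mu2) nu = inner mu1 nu + inner mu2 nu.
Proof.
move=> h1 h2 hn; have [m1 _] := h1; have [m2 _] := h2; have [mn _] := hn.
rewrite {1}inner.unlock (mutual_energyDl m1 m2 mn).
by rewrite (inner_fin h1 hn) (inner_fin h2 hn).
Qed.

Lemma innerDr mu1 mu2 nu : E mu1 -> E mu2 -> E nu ->
  inner nu (measure_add mu1 mu2) = inner nu mu1 + inner nu mu2.
Proof.
move=> h1 h2 hn; have h12 := Eplus_add h1 h2.
by rewrite (innerC hn h12) (innerDl h1 h2 hn) (innerC h1 hn) (innerC h2 hn).
Qed.

Lemma innerZl (c : {nonneg R}) mu nu : E mu -> E nu ->
  inner (mscale c mu) nu = c%:num * inner mu nu.
Proof.
move=> h1 hn; have [m1 _] := h1; have [mn _] := hn.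
rewrite {1}inner.unlock (mutual_energyZl c m1 mn).
by rewrite (inner_fin h1 hn).
Qed.

Lemma innerZr (c : {nonneg R}) mu nu : E mu -> E nu ->
  inner nu (mscale c mu) = c%:num * inner nu mu.
Proof.
move=> h1 hn; have h1c := Eplus_scale c h1.
by rewrite (innerC hn h1c) (innerZl c h1 hn) (innerC h1 hn).
Qed.

Lemma inner0l mu : E mu -> inner mzero mu = 0.
Proof. by move=> [hm _]; rewrite inner.unlock (mutual_energy0 hm). Qed.

Lemma inner_ge0 mu nu : E mu -> E nu -> 0 <= inner mu nu.
Proof.
move=> [hm _] [hn _]; rewrite inner.unlock; apply: fine_ge0.
exact: mutual_energy_ge0.
Qed.

Definition sqdist mu nu := inner mu mu - 2 * inner mu nu + inner nu nu.

Lemma strong_distE mu nu : strong_dist kappa mu nu = Num.sqrt (sqdist mu nu).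
Proof. by rewrite /sqdist inner.unlock. Qed.

Lemma sqdist_ge0 mu nu : E mu -> E nu -> 0 <= sqdist mu nu.
Proof. by move=> hm hn; have [] := energy_difference hm hn. Qed.

Lemma sqdistC mu nu : E mu -> E nu -> sqdist mu nu = sqdist nu mu.
Proof. by move=> hm hn; rewrite /sqdist (innerC hm hn); ring. Qed.

Lemma strong_distC mu nu : E mu -> E nu ->
  strong_dist kappa mu nu = strong_dist kappa nu mu.
Proof. by move=> hm hn; rewrite !strong_distE sqdistC. Qed.

Lemma sqdist_eq0 mu nu : E mu -> E nu -> sqdist mu nu = 0 -> same_measure mu nu.
Proof. by move=> hm hn; have [] := energy_difference hm hn. Qed.

(** Cauchy-Schwarz inequality for the signed measures [a - b] and [c - d], written with positive
    measures only. The nonnegative quadratic polynomial in [s] is the squared distance between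
    [a + s d] and [b + s c]. *)
Lemma inner_cauchy_schwarz (a b c d : borel_measure X R) :
  E a -> E b -> E c -> E d ->
  `|inner a c - inner a d - inner b c + inner b d| <=
  strong_dist kappa a b * strong_dist kappa c d.
Proof.
move=> ha hb hc hd; set D := (X in `|X|).
have key (c' d' : borel_measure X R) (s : R) : E c' -> E d' -> 0 <= s ->
    0 <= sqdist a b + 2 * s * (inner a d' - inner a c' - inner b d' + inner b c')
      + s ^+ 2 * sqdist c' d'.
  move=> hc' hd' s0.
  have hsc := Eplus_scale (NngNum s0) hc'; have hsd := Eplus_scale (NngNum s0) hd'.
  have h1 := Eplus_add ha hsd; have h2 := Eplus_add hb hsc.
  have := sqdist_ge0 h1 h2; rewrite /sqdist.
  rewrite (innerDl ha hsd h1) (innerDl hb hsc h2) (innerDl ha hsd h2).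
  rewrite (innerDr ha hsd ha) (innerDr ha hsd hsd) (innerDr hb hsc ha).
  rewrite (innerDr hb hsc hsd) (innerDr hb hsc hb) (innerDr hb hsc hsc).
  rewrite (innerZl _ hd' ha) (innerZl _ hd' hsd) (innerZl _ hd' hb).
  rewrite (innerZl _ hd' hsc) (innerZl _ hc' hb) (innerZl _ hc' hsc).
  rewrite (innerZr _ hd' ha) (innerZr _ hd' hd') (innerZr _ hc' ha).
  rewrite (innerZr _ hc' hd') (innerZr _ hc' hb) (innerZr _ hc' hc') /=.
  rewrite (innerC hd' ha) (innerC hc' hb) (innerC hd' hb) (innerC hd' hc').
  move/le_trans; apply; rewrite le_eqVlt; apply/orP; left; apply/eqP; ring.
rewrite !strong_distE -sqrtrM ?sqdist_ge0// -sqrtr_sqr ler_wsqrtr//.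
apply: discriminant_le; first exact: sqdist_ge0.
move=> s; have [s0|s0] := leP 0 s.
  apply: le_trans (key c d s hc hd s0) _.
  by rewrite le_eqVlt /D; apply/orP; left; apply/eqP; ring.
(* Measures can be scaled by nonnegative numbers only; for negative [s] the roles of [c] and [d] are
   exchanged. *)
have s0' : 0 <= - s by rewrite oppr_ge0 ltW.
apply: le_trans (key d c (- s) hd hc s0') _.
rewrite (sqdistC hd hc) le_eqVlt /D; apply/orP; left; apply/eqP; ring.
Qed.

Lemma strong_dist_ge0 mu nu : 0 <= strong_dist kappa mu nu.
Proof. exact: sqrtr_ge0. Qed.

Lemma strong_dist_sqr mu nu : E mu -> E nu ->
  strong_dist kappa mu nu ^+ 2 = sqdist mu nu.
Proof.
by move=> hm hn; rewrite strong_distE sqr_sqrtr//; exact: sqdist_ge0.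
Qed.

Lemma strong_dist_triangle (a b c : borel_measure X R) : E a -> E b -> E c ->
  strong_dist kappa a c <= strong_dist kappa a b + strong_dist kappa b c.
Proof.
move=> ha hb hc.
rewrite -ler_sqr ?nnegrE ?addr_ge0 ?strong_dist_ge0// sqrrD !strong_dist_sqr//.
have := inner_cauchy_schwarz ha hb hb hc => /(le_trans (ler_norm _)).
rewrite /sqdist => h.
rewrite -mulr_natr; lra.
Qed.

Definition enorm mu := Num.sqrt (inner mu mu).

Lemma inner_le_enorm mu nu : E mu -> E nu -> inner mu nu <= enorm mu * enorm nu.
Proof.
move=> hm hn; have h0 := Eplus0.
have := inner_cauchy_schwarz hm h0 hn h0 => /(le_trans (ler_norm _)).
rewrite !strong_distE /sqdist (innerC hm h0) (innerC hn h0).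
by rewrite !inner0l// !mulr0 !subr0 !addr0.
Qed.

(** * Capacity and exceptional sets *)

Lemma cap_ge0 (K : set X) : (0 <= cap kappa K)%E.
Proof.
rewrite /cap inve_ge0; apply: le_ereal_inf_tmp => _ [mu [[[hmu _] _] _] <-].
exact: mutual_energy_ge0.
Qed.

(** If [lam] charged a compact subset of [B], its normalized restriction would be a unit measure of
    finite energy there, and the capacity would be positive. Inner regularity then passes from
    compact sets to [B]. *)
Lemma inner_cap0_null (Q : set X) (B : set (borel X)) lam :
  inner_cap kappa Q = 0%E -> measurable B -> B `<=` Q -> E lam -> lam B = 0%E.
Proof.
move=> Q0 mB BQ hlam; have [hl el] := hlam.
have [C [cC _ CB lamC]] := radon_regular hl mB.
have mC n := borel_compact (cC n).
have C0 n : lam (C n) = 0%E.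
  apply: contrapT => /eqP Cn0.
  have Cfin : lam (C n) \is a fin_num by rewrite ge0_fin_numE//; exact: hl.
  have c0 : 0 < fine (lam (C n)) by rewrite fine_gt0// lt0e Cn0 measure_ge0 ltey_eq Cfin.
  have c0' : 0 <= (fine (lam (C n)))^-1 by rewrite invr_ge0 ltW.
  pose m : borel_measure X R := mscale (NngNum c0') (mrestr lam (mC n)).
  have hm : E m.
    by apply: Eplus_scale; exact: Eplus_restr.
  have mE B' : m B' = ((fine (lam (C n)))^-1%:E * lam (B' `&` C n))%E by [].
  have m1 : m [set: X] = 1%E.
    by rewrite mE setTI -{2}(fineK Cfin) -EFinM mulVf// gt_eqF.
  have hmC : Eplus_on kappa (C n) m.
    split => //; split; first by case: hm.
    exists (~` C n); split => //; first exact: measurableC.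
    by rewrite mE setICl measure0 mule0.
  pose S := [set energy kappa mu |
    mu in [set mu | Eplus_on kappa (C n) mu /\ mu [set: X] = 1%E]].
  have capC : cap kappa (C n) = 0%E.
    apply/eqP; rewrite eq_le; apply/andP; split.
      by rewrite -Q0; apply: ereal_sup_ubound; exists (C n) => //; split => //;
        exact: subset_trans BQ.
    exact: cap_ge0.
  (* [cap] is an inverse in [\bar R], so capacity zero forces the infimum to be [+oo]. *)
  have /eqP : ereal_inf S = +oo%E by apply/eqP; rewrite -inve_eq0; exact/eqP.
  have : (ereal_inf S <= energy kappa m)%E by apply: ereal_inf_lbound; exists m.
  by case: hm => _; case: (energy kappa m) => [r| |] // _; case: (ereal_inf S).
have mU : measurable (\bigcup_n C n : set (borel X)) by exact: bigcup_measurable.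
have U0 : lam (\bigcup_n C n) = 0%E.
  apply/negligibleP => //; apply: negligible_bigcup => n.
  by exists (C n); split.
have mD : measurable (B `\` \bigcup_n C n : set (borel X)) by exact: measurableD.
have : (lam B <= lam (B `\` \bigcup_n C n) + lam (\bigcup_n C n))%E.
  apply: le_trans (measureU2 _ mD mU).
  apply: le_measure; rewrite ?inE//; first exact: measurableU.
  by move=> x Bx; have [?|?] := pselect ((\bigcup_n C n) x); [right|left].
by rewrite lamC U0 adde0 measure_le0 => /eqP.
Qed.

(** [A] may fail to be Borel, so the set where the potentials differ is intersected with the
    complement of the null set [N]; the result is a Borel subset of [A] of inner capacity zero. *)
Lemma nearly_everywhere_ae (A : set X) mu nu lam :
  Mplus mu -> Mplus nu -> nearly_everywhere kappa A [set x | U nu x = U mu x] ->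
  Eplus_on kappa A lam -> {ae lam, forall x, U nu x = U mu x}.
Proof.
move=> hmu hnu ne [hlam [_ [N [mN N0 AN]]]].
have mmu := potential_measurable hmu.
have mnu := potential_measurable hnu.
pose D : set (borel X) := [set x | U nu x != U mu x].
have mD : measurable D.
  rewrite -[D]setTI; exact: emeasurable_fun_neq.
have ND0 : lam (~` N `&` D) = 0%E.
  apply: (inner_cap0_null ne) => //.
    by apply: measurableI => //; exact: measurableC.
  move=> x [nNx /eqP Dx]; split => //; apply: contrapT => nAx; exact/nNx/AN.
exists (N `|` (~` N `&` D)); split.
- by apply: measurableU => //; apply: measurableI => //; exact: measurableC.
- have mND : measurable (~` N `&` D) by apply: measurableI => //; exact: measurableC.
  have : (lam (N `|` (~` N `&` D)) <= lam N + lam (~` N `&` D))%E by exact: measureU2.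
  by rewrite N0 ND0 adde0 measure_le0 => /eqP.
- move=> x /= /eqP nx; have [Nx|nNx] := pselect (N x); [by left|by right].
Qed.

Lemma ae_mutual_energy mu nu lam : Mplus mu -> Mplus nu -> Mplus lam ->
  {ae lam, forall x, U nu x = U mu x} -> I lam nu = I lam mu.
Proof.
move=> hmu hnu hlam h; rewrite !(mutual_energyE)//.
apply: ae_eq_integral => //; try exact: potential_measurable.
by apply: negligibleS h => x /= hx e; apply: hx => _; rewrite e.
Qed.

(** * Balayage tested against measures carried by [A] *)

Lemma unit_mass_Mplus (x : X) : Mplus (unit_mass x : borel_measure X R).
Proof. by move=> K _; rewrite /= /unit_mass /dirac indicE ltry. Qed.

Lemma mutual_energy_unit_mass lam (x : X) : Mplus lam ->
  I lam (unit_mass x) = U lam x.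
Proof.
move=> hlam; rewrite (mutual_energyE hlam (unit_mass_Mplus x)).
apply: eq_integral => y _; rewrite /potential integral_dirac//.
  by rewrite diracT mul1e; case: hk.
exact: (measurableT_comp (kernel_measurable) (pair1_measurable y)).
Qed.

Lemma Eprime_approx (A : set X) lam (e : R) : Eprime kappa A lam -> 0 < e ->
  exists2 lam', Eplus_on kappa A lam' & dist lam lam' < e.
Proof.
move=> [hlam h] e0; apply: (h [set nu | dist lam nu < e]).
by exists e.
Qed.

(** The potentials agree almost everywhere for [lam]. The identity is between extended values
    because [mu] may be a unit mass, whose energy can be infinite. *)
Lemma balayage_inner (A : set X) mu nu lam :
  Mplus mu -> Mplus nu -> nearly_everywhere kappa A [set x | U nu x = U mu x] ->
  Eplus_on kappa A lam -> I lam nu = I lam mu.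
Proof.
move=> hmu hnu ne hlam; apply: ae_mutual_energy => //; first by case: hlam => -[].
exact: (nearly_everywhere_ae hmu hnu ne).
Qed.

(** Both balayages have the same inner product with measures of finite energy carried by [A] and, by
    Cauchy-Schwarz, with their strong limits, in particular with [nu1] and [nu2]; so their distance
    is zero. *)
Lemma inner_balayage_unique (A : set X) mu nu1 nu2 : Mplus mu ->
  inner_balayage kappa A mu nu1 -> inner_balayage kappa A mu nu2 ->
  same_measure nu1 nu2.
Proof.
move=> hmu [h1 ne1] [h2 ne2]; have [E1 _] := h1; have [E2 _] := h2.
apply: sqdist_eq0 => //.
have key lam : Eprime kappa A lam -> inner nu1 lam = inner nu2 lam.
  move=> hlam; have [El _] := hlam.
  apply/eqP; rewrite -subr_eq0 -normr_le0; apply/ler_addgt0Pr => e e0.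
  rewrite add0r; pose c := dist nu1 nu2 + 1.
  have c0 : 0 < c by rewrite ltr_wpDl// strong_dist_ge0.
  have [lam' hlam' dl] := Eprime_approx hlam (divr_gt0 e0 c0).
  have [El' [Ml' _]] := hlam'.
  have eq' : inner lam' nu1 = inner lam' nu2.
    rewrite inner.unlock (balayage_inner hmu E1.1 ne1 hlam').
    by rewrite (balayage_inner hmu E2.1 ne2 hlam').
  have := inner_cauchy_schwarz E1 E2 El El'.
  rewrite (innerC E1 El') (innerC E2 El') eq'.
  rewrite (_ : _ - _ - _ + _ = inner nu1 lam - inner nu2 lam); last by ring.
  move/le_trans; apply.
  apply: (@le_trans _ _ (c * (e / c))); last by rewrite mulrC divfK ?gt_eqF.
  by apply: ler_pM; [exact: strong_dist_ge0|exact: strong_dist_ge0|rewrite lerDl|exact: ltW].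
rewrite /sqdist (key nu1 h1) (innerC E2 E1) (key nu2 h2).
by ring.
Qed.

(** A compact subset of the exceptional set lies in each open set containing it, so inner capacity
    is at most outer capacity. *)
Lemma quasi_nearly_everywhere (A P : set X) :
  quasi_everywhere kappa A P -> nearly_everywhere kappa A P.
Proof.
rewrite /quasi_everywhere /nearly_everywhere => h; apply/eqP; rewrite eq_le.
apply/andP; split.
  rewrite -h; apply: le_ereal_inf_tmp => _ [G [oG AG] <-].
  apply: ge_ereal_sup => _ [K [cK KA] <-]; apply: ereal_sup_ubound.
  by exists K => //; split => //; exact: subset_trans AG.
apply: le_trans (cap_ge0 set0) _; apply: ereal_sup_ubound.
by exists set0 => //; split => //; exact: compact0.
Qed.

(** * Stability of the cone of measures carried by a set *)

Lemma Eplus_on_add (K : set X) mu nu :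
  Eplus_on kappa K mu -> Eplus_on kappa K nu -> Eplus_on kappa K (measure_add mu nu).
Proof.
move=> [Em [Mm nm]] [En [Mn nn]]; split; first exact: Eplus_add.
split; first exact: Mplus_add.
have [N1 [mN1 N10 KN1]] := nm; have [N2 [mN2 N20 KN2]] := nn.
exists (N1 `&` N2); split; first exact: measurableI.
  rewrite [LHS]measure_addE [X in (X + _)%E](_ : _ = 0%E) ?add0e; last first.
    apply/eqP; rewrite eq_le measure_ge0 andbT -N10.
    by apply: le_measure; rewrite ?inE//; exact: measurableI.
  apply/eqP; rewrite eq_le measure_ge0 andbT -N20.
  by apply: le_measure; rewrite ?inE//; exact: measurableI.
by move=> x Kx; split; [exact: KN1|exact: KN2].
Qed.

Lemma Eplus_on_scale (K : set X) (c : {nonneg R}) mu :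
  Eplus_on kappa K mu -> Eplus_on kappa K (mscale c mu).
Proof.
move=> [Em [Mm [N [mN N0 KN]]]]; split; first exact: Eplus_scale.
split; first exact: Mplus_scale.
by exists N; split => //; rewrite /= /mscale N0 mule0.
Qed.

Lemma Eplus_on_restr (K : set X) mu (D : set (borel X)) (mD : measurable D) :
  Eplus_on kappa K mu -> Eplus_on kappa K (mrestr mu mD).
Proof.
move=> [Em [Mm [N [mN N0 KN]]]]; split; first exact: Eplus_restr.
split; first exact: Mplus_restr.
exists N; split => //; apply/eqP; rewrite eq_le measure_ge0 andbT -N0.
by rewrite /= /mrestr; apply: le_measure; rewrite ?inE//; exact: measurableI.
Qed.

Lemma Eplus_on0 (K : set X) : Eplus_on kappa K mzero.
Proof.
split; first exact: Eplus0.
split; first exact: Mplus0.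
by exists setT; split.
Qed.

Lemma Eplus_onS (K K' : set X) mu : K `<=` K' -> Eplus_on kappa K mu ->
  Eplus_on kappa K' mu.
Proof.
move=> KK [Em [Mm nm]]; split => //; split => //.
by apply: negligibleS nm; exact: subsetC.
Qed.

(** * Projections onto cones of measures carried by compact sets *)

Hypothesis hcomplete : strongly_complete kappa.
Hypothesis hfiner : strong_finer_than_vague kappa.
Hypothesis hdom : domination_principle kappa.

(** Strong convergence implies vague convergence, so [mu] annihilates every nonnegative test
    function supported off [K]. Countably many of the sets where such functions are positive cover
    the complement of [K]. *)
Lemma strong_limit_carried (K : set X) (u : nat -> borel_measure X R) mu :
  compact K -> (forall n, Eplus_on kappa K (u n)) -> E mu ->
  dist (u n) mu @[n --> \oo] --> (0 : R) -> Eplus_on kappa K mu.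
Proof.
move=> cK hu hmu u_mu; split => //; have [Mmu _] := hmu; split => //.
have clK := compact_closed hX cK.
have mK := borel_compact cK.
have int0 (phi : X -> R) : C0 phi -> (forall y, 0 <= phi y) ->
    supp phi `<=` ~` K -> (\int[mu]_x (phi x)%:E = 0)%E.
  move=> hphi phi0 sphi.
  have fin : (\int[mu]_x (phi x)%:E)%E \is a fin_num.
    exact: (integrable_fin_num measurableT (C0_integrable Mmu hphi)).
  suff : fine (\int[mu]_x (phi x)%:E)%E = 0 by move=> h; rewrite -(fineK fin) h.
  apply/eqP; rewrite -normr_le0; apply/ler_addgt0Pr => e e0; rewrite add0r.
  have vn : vague_nbhs kappa mu
      [set nu : borel_measure X R | `|(\int[nu]_x phi x) - (\int[mu]_x phi x)| < e].
    exists 1%N, (fun=> phi), e; split => // nu _ /(_ ord0).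
    exact.
  have [d d0 hd] := hfiner hmu vn.
  have [N _ hN] : \forall n \near \oo, `|0 - dist (u n) mu| < d.
    by move/cvgrPdist_lt : u_mu; apply.
  have Eun : E (u N) by case: (hu N).
  have := hd (u N) Eun; rewrite (strong_distC hmu Eun) /=.
  have := hN N (leqnn N); rewrite /= sub0r normrN ger0_norm ?strong_dist_ge0//.
  move=> -> /(_ isT); rewrite /Rintegral.
  have -> : (\int[u N]_x (phi x)%:E = 0)%E.
    rewrite -(integral0 (u N) setT); apply: ae_eq_integral => //.
      by apply/measurable_EFinP; apply: continuous_borel; case: hphi.
    have [_ [_ nK]] := hu N; apply: negligibleS nK => x /= hx Kx; apply: hx => _.
    congr (_%:E); apply/eqP/negPn/negP => phix.
    by apply: (sphi x) => //; exact: subset_closure.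
  by rewrite sub0r normrN => /ltW.
pose phi x := xget (fun=> 0) [set f : X -> R |
  [/\ C0 f, forall y, 0 <= f y, f x = 1 & supp f `<=` ~` K]].
have phiP x : (~` K) x ->
    [/\ C0 (phi x), forall y, 0 <= phi x y, phi x x = 1 & supp (phi x) `<=` ~` K].
  move=> nKx; have [f fP] := bump (closed_openC clK) nKx.
  by rewrite /phi; case: xgetP => [g _ //|/(_ f)].
pose O x := [set y | 0 < phi x y].
have [v vP] : exists v : nat -> X,
    ~` K `<=` \bigcup_(n in [set n | (~` K) (v n)]) O (v n).
  apply: lindelof => x nKx; have [[cphi _] phi0 phi1 _] := phiP x nKx.
  split; last by rewrite /O /= phi1.
  by move/continuousP : cphi => /(_ _ (@open_gt R 0)).
suff [N [mN N0 ON]] : mu.-negligible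
    (\bigcup_(n in [set n | (~` K) (v n)]) O (v n) : set (borel X)).
  by exists N; split => //; exact: subset_trans vP ON.
rewrite bigcup_mkcond; apply: negligible_bigcup => n.
case: ifPn => [|_]; last exact: negligible_set0.
rewrite inE /= => nKv; have [hphi phi0 _ sphi] := phiP _ nKv.
have mphi : measurable_fun [set: borel X] (fun x : borel X => (phi (v n) x)%:E).
  by apply/measurable_EFinP; apply: continuous_borel; case: hphi.
have := int0 _ hphi phi0 sphi.
rewrite (_ : (\int[mu]_x _)%E = \int[mu]_x `|(phi (v n) x)%:E|)%E; last first.
  by apply: eq_integral => x _; rewrite gee0_abs// lee_fin.
move/(ae_eq_integral_abs mu measurableT mphi).
apply: negligibleS => x /= phix h; have := h Logic.I; move=> -[] phix0.
by move: phix; rewrite /O /= phix0 ltxx.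
Qed.

Definition is_projection (K : set X) theta p :=
  Eplus_on kappa K p /\ forall nu, Eplus_on kappa K nu -> dist theta p <= dist theta nu.

(** A minimizing sequence is Cauchy by the parallelogram law, because the cone contains midpoints;
    completeness yields a limit, and [strong_limit_carried] keeps it in the cone. *)
Lemma projection_exists (K : set X) theta : compact K -> E theta ->
  exists p, is_projection K theta p.
Proof.
move=> cK Et.
pose S := [set dist theta nu | nu in Eplus_on kappa K].
have hS : has_inf S.
  split; first by exists (dist theta mzero); exists mzero => //; exact: Eplus_on0.
  by exists 0 => _ [nu _ <-]; exact: strong_dist_ge0.
pose d := inf S.
have dle nu : Eplus_on kappa K nu -> d <= dist theta nu.
  by move=> hnu; apply: ge_inf; [exact: hS.2|exists nu].
have d0 : 0 <= d by apply: lb_le_inf; [exact: hS.1|move=> _ [nu _ <-]; exact: strong_dist_ge0].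
have /choice[u uP] n : exists nu, Eplus_on kappa K nu /\ dist theta nu < d + n.+1%:R^-1.
  have n0 : 0 < n.+1%:R^-1 :> R by rewrite invr_gt0.
  by have [_ [nu hnu <-]] := inf_adherent n0 hS; exists nu.
have Eu n : E (u n) by case: (uP n) => -[].
have half0 : (0 : R) <= 2^-1 by rewrite invr_ge0.
(* Parallelogram law at the midpoint [c], whose distance to [theta] is at least [d]: the bound is
   [4 * (d + e) ^+ 2 - 4 * d ^+ 2]. *)
have par m n (e : R) : 0 <= e -> dist theta (u m) <= d + e ->
    dist theta (u n) <= d + e ->
    dist (u m) (u n) ^+ 2 <= 8 * d * e + 4 * e ^+ 2.
  move=> e0 hm hn.
  pose c := measure_add (mscale (NngNum half0) (u m)) (mscale (NngNum half0) (u n)).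
  have cK' : Eplus_on kappa K (c : borel_measure X R).
    by apply: Eplus_on_add => //; apply: Eplus_on_scale => //; case: (uP m); case: (uP n).
  have Ec := cK'.1.
  have Ehm := Eplus_scale (NngNum half0) (Eu m).
  have Ehn := Eplus_scale (NngNum half0) (Eu n).
  have hc : d ^+ 2 <= sqdist theta c.
    rewrite -(strong_dist_sqr Et Ec) ler_sqr ?nnegrE ?strong_dist_ge0//.
    exact: dle.
  have hm2 : sqdist theta (u m) <= (d + e) ^+ 2.
    rewrite -(strong_dist_sqr Et (Eu m)).
    by apply: lerXn2r => //; rewrite nnegrE; [exact: strong_dist_ge0|exact: addr_ge0].
  have hn2 : sqdist theta (u n) <= (d + e) ^+ 2.
    rewrite -(strong_dist_sqr Et (Eu n)).
    by apply: lerXn2r => //; rewrite nnegrE; [exact: strong_dist_ge0|exact: addr_ge0].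
  rewrite (strong_dist_sqr (Eu m) (Eu n)).
  move: hc hm2 hn2; rewrite /sqdist.
  rewrite (innerDr Ehm Ehn Et) (innerDl Ehm Ehn Ec).
  rewrite (innerDr Ehm Ehn Ehm) (innerDr Ehm Ehn Ehn).
  rewrite !(innerZl _ (Eu m) Ehm) !(innerZl _ (Eu m) Ehn).
  rewrite !(innerZl _ (Eu n) Ehm) !(innerZl _ (Eu n) Ehn).
  rewrite !(innerZr _ (Eu m) Et) !(innerZr _ (Eu n) Et).
  rewrite !(innerZr _ (Eu m) (Eu m)) !(innerZr _ (Eu m) (Eu n)).
  rewrite !(innerZr _ (Eu n) (Eu m)) !(innerZr _ (Eu n) (Eu n)) /=.
  rewrite (innerC (Eu n) (Eu m)).
  move: (inner theta theta) (inner theta (u m)) (inner theta (u n))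
    (inner (u m) (u m)) (inner (u m) (u n)) (inner (u n) (u n)) => *; nra.
have near (e : R) : 0 < e -> exists N, forall n, (N <= n)%N -> n.+1%:R^-1 < e.
  move=> e0; have [N _ hN] := near_infty_natSinv_lt (PosNum e0).
  by exists N => n; exact: hN.
have uK n (e : R) : n.+1%:R^-1 < e -> dist theta (u n) <= d + e.
  by move=> ne; have [_ /ltW/le_trans] := uP n; apply; rewrite lerD2l ltW.
have [mu Emu umu] : exists2 mu, E mu & dist (u n) mu @[n --> \oo] --> (0 : R).
  apply: hcomplete => // e e0.
  pose c := 8 * d + 4; have c0 : 0 < c by rewrite /c; lra.
  (* For [s <= 1] the bound [8 * d * s + 4 * s ^+ 2] is at most [c * s], and the second entry of the
     minimum makes this at most [e ^+ 2 / 2]. *)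
  pose s := Num.min 1 (e ^+ 2 / c / 2).
  have e2 : 0 < e ^+ 2 by rewrite exprn_gt0.
  have s0 : 0 < s by rewrite lt_min ltr01 divr_gt0// divr_gt0.
  have [N hN] := near s s0; exists N => m n Nm Nn.
  rewrite -ltr_sqr ?nnegrE ?strong_dist_ge0 ?ltW//.
  apply: le_lt_trans (par m n s (ltW s0) (uK _ _ (hN _ Nm)) (uK _ _ (hN _ Nn))) _.
  have s1 : s <= 1 by rewrite ge_min lexx.
  have s2 : s <= e ^+ 2 / c / 2 by rewrite ge_min lexx orbT.
  apply: (@le_lt_trans _ _ (c * s)); first by rewrite /c; nra.
  apply: (@le_lt_trans _ _ (e ^+ 2 / 2)); last by rewrite ltr_pdivrMr//; lra.
  by rewrite mulrC -ler_pdivlMr// (le_trans s2)// le_eqVlt mulrAC eqxx.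
have muK : Eplus_on kappa K mu by apply: strong_limit_carried umu => // n; case: (uP n).
exists mu; split => // nu /dle; apply: le_trans.
apply/ler_addgt0Pr => e e0; have e20 : 0 < e / 2 by rewrite divr_gt0.
have [N hN] := near _ e20.
have [M _ hM] : \forall n \near \oo, `|0 - dist (u n) mu| < e / 2.
  by move/cvgrPdist_lt : umu; apply.
pose n := maxn N M.
have h1 : dist theta (u n) <= d + e / 2 by apply: uK; apply: hN; exact: leq_maxl.
have h2 : dist (u n) mu < e / 2.
  by have := hM n (leq_maxr _ _); rewrite /= sub0r normrN ger0_norm// strong_dist_ge0.
have := strong_dist_triangle Et (Eu n) Emu.
lra.
Qed.

Lemma projection_sqdist (K : set X) theta p nu : E theta ->
  is_projection K theta p -> Eplus_on kappa K nu ->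
  sqdist theta p <= sqdist theta nu.
Proof.
move=> Et [[Ep _] hp] hnu; have En := hnu.1.
rewrite -(strong_dist_sqr Et Ep).
rewrite -(strong_dist_sqr Et En).
apply: lerXn2r; last exact: hp.
all: by rewrite nnegrE; exact: strong_dist_ge0.
Qed.

Lemma sqdist_add_scale theta mu nu (t : {nonneg R}) : E theta -> E mu -> E nu ->
  sqdist theta (measure_add mu (mscale t nu)) =
  sqdist theta mu - 2 * t%:num * (inner theta nu - inner mu nu)
    + t%:num ^+ 2 * inner nu nu.
Proof.
move=> Et Em En; have Etn := Eplus_scale t En.
have Ea := Eplus_add Em Etn.
rewrite /sqdist (innerDr Em Etn Et).
rewrite (innerDl Em Etn Ea).
rewrite (innerDr Em Etn Em) (innerDr Em Etn Etn).
rewrite (innerZr t En Et) (innerZr t En Em).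
rewrite (innerZl t En Em) (innerZl t En Etn).
rewrite (innerZr t En En) (innerC En Em).
ring.
Qed.

(** First-order condition along the admissible variation [p + t lam]. *)
Lemma projection_inner_le (K : set X) theta p lam : E theta ->
  is_projection K theta p -> Eplus_on kappa K lam ->
  inner theta lam <= inner p lam.
Proof.
move=> Et hp hlam; have Ep := hp.1.1; have El := hlam.1.
rewrite -subr_le0.
apply: (linear_le_quadratic (inner_ge0 El El)) => t t0 _.
have hadd : Eplus_on kappa K (measure_add p (mscale (NngNum (ltW t0)) lam)).
  apply: Eplus_on_add; first exact: hp.1.
  exact: Eplus_on_scale.
have := projection_sqdist Et hp hadd; rewrite sqdist_add_scale//=; lra.
Qed.

(** First-order condition along the admissible variation [(1 - t) p], opposite to the variation
    [p + t p]. *)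
Lemma projection_inner_self (K : set X) theta p : E theta ->
  is_projection K theta p -> inner p p <= inner theta p.
Proof.
move=> Et hp; have Ep := hp.1.1; rewrite -subr_le0.
apply: (linear_le_quadratic (inner_ge0 Ep Ep)) => t t0 t1.
have s0 : 0 <= 1 - t by rewrite subr_ge0.
have hs : Eplus_on kappa K (mscale (NngNum s0) p).
  by apply: Eplus_on_scale; exact: hp.1.
have := projection_sqdist Et hp hs; rewrite /sqdist.
have Es := hs.1.
rewrite (innerZr _ Ep Et) (innerZl _ Ep Es).
rewrite (innerZr _ Ep Ep) /=.
move: (inner theta theta) (inner theta p) (inner p p) => a b c; nra.
Qed.

(** The first-order condition is tested against the restriction of [lam] to the set where
    [U p < U theta]. The integrals compare the other way there, so the potentials agree almost
    everywhere for this restriction, and the set is null. *)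
Lemma projection_potential_ge (K : set X) theta p lam : E theta ->
  is_projection K theta p -> Eplus_on kappa K lam ->
  {ae lam, forall x, (U theta x <= U p x)%E}.
Proof.
move=> Et hp hlam; have Ep := hp.1.1; have El := hlam.1.
have mt := potential_measurable Et.1.
have mp := potential_measurable Ep.1.
pose B : set (borel X) := [set x | (U p x < U theta x)%E].
have mB : measurable B by rewrite -[B]setTI; exact: emeasurable_fun_lt.
have hm := Eplus_on_restr mB hlam.
set m : borel_measure X R := mrestr lam mB in hm.
have Em : E m by case: hm.
have le := projection_inner_le Et hp hm.
rewrite (innerC Et Em) (innerC Ep Em) -lee_fin in le.
rewrite -(inner_fin Em Et) -(inner_fin Em Ep) in le.
rewrite (mutual_energyE Em.1 Et.1) in le.
rewrite (mutual_energyE Em.1 Ep.1) in le.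
have fin : (\int[m]_x U p x < +oo)%E.
  rewrite -(mutual_energyE Em.1 Ep.1).
  by rewrite (inner_fin Em Ep) ltry.
have aele : {ae m, forall x, (U p x <= U theta x)%E}.
  exists (~` B); split; first exact: measurableC.
    by rewrite /m /= /mrestr setICl measure0.
  by move=> x /= nle Bx; apply: nle; exact: ltW.
have [N [mN N0 BN]] := ae_eq_of_integral_le mp mt (potential_ge0 p)
  (potential_ge0 theta) aele le fin.
exists B; split => //.
  have : (m B <= m N)%E.
    apply: le_measure; rewrite ?inE// => x Bx; apply: BN => /= e.
    by move: Bx; rewrite /B /= e ltxx.
  by rewrite N0 /m /= /mrestr setIid measure_le0 => /eqP.
by move=> x /= /negP; rewrite -ltNge.
Qed.

(** [U theta <= U p] holds almost everywhere for [p], while the integrals against [p] satisfy the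
    reverse inequality. Hence the potentials agree almost everywhere for [p], and the domination
    principle extends the bound to the whole space. *)
Lemma projection_potential_le (K : set X) theta p : E theta ->
  is_projection K theta p -> forall x, (U p x <= U theta x)%E.
Proof.
move=> Et hp; have Ep := hp.1.1; apply: hdom => //; first exact: Et.1.
have ge := projection_potential_ge Et hp hp.1.
have := projection_inner_self Et hp.
rewrite (innerC Et Ep) -lee_fin.
rewrite -(inner_fin Ep Et) -(inner_fin Ep Ep).
rewrite (mutual_energyE Ep.1 Et.1).
rewrite (mutual_energyE Ep.1 Ep.1) => le.
have fin : (\int[p]_x U theta x < +oo)%E.
  rewrite -(mutual_energyE Ep.1 Et.1).
  by rewrite (inner_fin Ep Et) ltry.
have := ae_eq_of_integral_le (potential_measurable Et.1)
  (potential_measurable Ep.1) (potential_ge0 theta)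
  (potential_ge0 p) ge le fin.
by apply: negligibleS => x /= h e; apply: h; rewrite e.
Qed.

(** As [p] is also carried by [K'], [U p <= U theta <= U p'] holds almost everywhere for [p], and
    the domination principle applies. *)
Lemma projection_potential_mono (K K' : set X) theta p p' : K `<=` K' ->
  E theta -> is_projection K theta p -> is_projection K' theta p' ->
  forall x, (U p x <= U p' x)%E.
Proof.
move=> KK Et hp hp'; have Ep := hp.1.1; apply: hdom => //; first exact: hp'.1.1.1.
have := projection_potential_ge Et hp' (Eplus_onS KK hp.1).
apply: negligibleS => x /= h e; apply: h; apply: le_trans e.
exact: (projection_potential_le Et hp).
Qed.

(** Restrict [lam] to increasing compact subsets of [A] that exhaust it up to a null set: the energy
    does not increase, and the mutual energy with [theta] converges. *)
Lemma compact_approx (A : set X) theta lam (e : R) : E theta ->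
  Eplus_on kappa A lam -> 0 < e ->
  exists C nu, [/\ compact C, C `<=` A, Eplus_on kappa C nu &
    sqdist theta nu < sqdist theta lam + e].
Proof.
move=> Et hlam e0; have El := hlam.1.
have [_ [_ [N [mN N0 AN]]]] := hlam.
have mNC := measurableC mN.
have [C [cC ndC CN lamC]] := radon_regular El.1 mNC.
have mC n := borel_compact (cC n).
have mt := potential_measurable Et.1.
have mU : measurable (\bigcup_n C n : set (borel X)) by exact: bigcup_measurable.
have UC0 : lam (~` (\bigcup_n C n)) = 0%E.
  have mD : measurable (~` N `\` \bigcup_n C n : set (borel X)) by exact: measurableD.
  have : (lam (~` (\bigcup_n C n)) <= lam (~` N `\` \bigcup_n C n) + lam N)%E.
    apply: (@le_trans _ _ (lam ((~` N `\` \bigcup_n C n) `|` N))).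
      apply: le_measure; rewrite ?inE//.
      - exact: measurableC.
      - exact: measurableU.
      - by move=> x nCx; have [Nx|nNx] := pselect (N x); [right|left].
    exact: measureU2.
  by rewrite lamC N0 adde0 measure_le0 => /eqP.
have Er n := Eplus_restr (mC n) El.
have Irestr n : I (mrestr lam (mC n)) theta = (\int[lam]_(x in C n) U theta x)%E.
  rewrite (mutual_energyE (Er n).1 Et.1).
  by apply: ge0_integral_mrestr => // x; exact: potential_ge0.
have cvgI : (\int[lam]_(x in C n) U theta x)%E @[n --> \oo] --> I lam theta.
  have -> : I lam theta = (\int[lam]_(x in \bigcup_n C n) U theta x)%E.
    rewrite (mutual_energyE El.1 Et.1).
    rewrite (@ge0_negligible_integral _ _ _ lam setT (~` (\bigcup_n C n)))//.
    - by rewrite setTD setCK.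
    - exact: measurableC.
    - by move=> x _; exact: potential_ge0.
  apply: ge0_nondecreasing_set_cvg_integral => //.
  - by move=> n; exact: measurable_funTS.
  - by move=> n x _; exact: potential_ge0.
have cvgi : inner (mrestr lam (mC n)) theta @[n --> \oo] --> inner lam theta.
  have -> : (fun n => inner (mrestr lam (mC n)) theta) =
      fine \o (fun n => \int[lam]_(x in C n) U theta x)%E.
    by apply/funext => n; rewrite inner.unlock Irestr.
  by apply: fine_cvg; rewrite -(inner_fin El Et).
have e20 : 0 < e / 2 by rewrite divr_gt0.
have [n _ hn] : \forall n \near \oo,
    `|inner lam theta - inner (mrestr lam (mC n)) theta| < e / 2.
  by move/cvgrPdist_lt : cvgi; apply.
exists (C n), (mrestr lam (mC n)); split => //.
- by apply: subset_trans (CN n) _ => x nNx; apply: contrapT => nAx; exact/nNx/AN.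
- split => //; split; first exact: (Er n).1.
  exists (~` C n); split => //; first exact: measurableC.
  by rewrite /= /mrestr setICl measure0.
have := hn n (leqnn n) => /=.
have le : inner (mrestr lam (mC n)) (mrestr lam (mC n)) <= inner lam lam.
  rewrite -lee_fin -(inner_fin (Er n) (Er n)).
  rewrite -(inner_fin El El).
  exact: (energy_restr_le (mC n) El.1).
rewrite /sqdist (innerC Et El) (innerC Et (Er n)).
move=> /(le_lt_trans (ler_norm _)); lra.
Qed.

Lemma inner_le_potential mu nu lam : E mu -> E nu -> E lam ->
  (forall x, (U mu x <= U nu x)%E) -> inner mu lam <= inner nu lam.
Proof.
move=> Em En El le.
rewrite (innerC Em El) (innerC En El) -lee_fin.
rewrite -(inner_fin El Em) -(inner_fin El En).
rewrite (mutual_energyE El.1 Em.1).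
rewrite (mutual_energyE El.1 En.1).
apply: ge0_le_integral => //.
- by move=> x _; exact: potential_ge0.
- exact: (potential_measurable Em.1).
- exact: (potential_measurable En.1).
Qed.

(* [p n] is the projection of [theta] onto the cone of measures carried by
   [K n], for compact sets [K n] increasing fast enough inside [A]. *)
Lemma projections_increasing (A : set X) theta : E theta ->
  exists p : nat -> borel_measure X R,
  [/\ forall n, Eplus_on kappa A (p n),
      forall m n x, (m <= n)%N -> (U (p m) x <= U (p n) x)%E,
      forall n x, (U (p n) x <= U theta x)%E,
      forall n, dist theta (p n) <= enorm theta &
      forall n nu, Eplus_on kappa A nu ->
        sqdist theta (p n) <= sqdist theta nu + 2 * n.+1%:R^-1].
Proof.
move=> Et.
pose S := [set sqdist theta nu | nu in Eplus_on kappa A].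
have Slb : lbound S 0.
  by move=> _ [nu hnu <-]; exact: (sqdist_ge0 Et hnu.1).
have hS : has_inf S.
  split; last by exists 0.
  by exists (sqdist theta mzero); exists mzero => //; exact: Eplus_on0.
have pos n : 0 < n.+1%:R^-1 :> R by rewrite invr_gt0.
(* The error [n.+1%:R^-1] is spent twice: for a near-minimizer carried by [A], and for its
   replacement by a measure carried by a compact subset. *)
have /choice[C CP] n : exists C, [/\ compact C, C `<=` A &
    exists2 nu, Eplus_on kappa C nu & sqdist theta nu < inf S + 2 * n.+1%:R^-1].
  have [_ [lam hlam <-] lamS] := inf_adherent (pos n) hS.
  have [C [nu [cC CA hnu lt]]] :=
    compact_approx Et hlam (pos n).
  exists C; split => //; exists nu => //; apply: lt_le_trans lt _.
  by rewrite mulr_natl mulr2n addrA lerD2r ltW.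
(* Finite unions make the compact sets increasing, and the near-minimizer on [C n] stays admissible
   on [K n]. *)
pose K n := \big[setU/set0]_(i < n.+1) C i.
have cK n : compact (K n) by apply: bigsetU_compact => i _; case: (CP i).
have KA n : K n `<=` A.
  rewrite /K -bigcup_mkord; apply: bigcup_sub => i _; by case: (CP i).
have CK n : C n `<=` K n.
  by rewrite /K -bigcup_mkord => x Cx; exists n => /=.
have KS m n : (m <= n)%N -> K m `<=` K n by move=> mn; exact: subset_bigsetU.
have /choice[p pP] n := projection_exists (cK n) Et.
exists p; split.
- by move=> n; exact: (Eplus_onS (KA n) (pP n).1).
- move=> m n x mn.
  exact: (projection_potential_mono (KS _ _ mn) Et (pP m) (pP n)).
- by move=> n x; exact: (projection_potential_le Et (pP n)).
- move=> n; have h0 := Eplus_on0 (K n).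
  apply: le_trans ((pP n).2 _ h0) _; rewrite strong_distE /enorm /sqdist.
  rewrite (innerC Et h0.1) (inner0l Et).
  by rewrite (inner0l h0.1) mulr0 subr0 addr0.
- move=> n nu hnu; have [_ _ [nu' hnu' lt]] := CP n.
  have := projection_sqdist Et (pP n) (Eplus_onS (CK n) hnu').
  move/le_trans; apply; apply: le_trans (ltW lt) _; rewrite lerD2r.
  by apply: ge_inf; [exists 0|exists nu].
Qed.

(* Since [p n + t lam'] is carried by [A] for all [t >= 0], the almost minimality
   of [p n] forces [inner (theta - p n) lam'] to be asymptotically nonpositive. *)
Lemma balayage_approx (A : set X) theta : E theta ->
  exists p : nat -> borel_measure X R,
  [/\ forall n, Eplus_on kappa A (p n),
      forall m n x, (m <= n)%N -> (U (p m) x <= U (p n) x)%E &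
      forall lam, Eprime kappa A lam ->
        inner (p n) lam @[n --> \oo] --> inner theta lam].
Proof.
move=> Et; have [p [pA pmono ptheta pnorm pmin]] := projections_increasing A Et.
exists p; split => // lam hlam; have El := hlam.1.
have Ep n := (pA n).1.
apply/cvgrPdist_le => e e0.
pose c := enorm theta + 1.
have c0 : 0 < c by rewrite ltr_wpDl// sqrtr_ge0.
have ec0 : 0 < e / 2 / c by rewrite !divr_gt0.
have [lam' hlam' dl] := Eprime_approx hlam ec0; have El' := hlam'.1.
pose L := inner lam' lam'.
have L0 : 0 <= L := inner_ge0 El' El'.
(* This gives [t * L <= e / 2]. For large [n] the error [2 * n.+1%:R^-1] in the almost minimality is
   below [t * e / 2], so that division by [2 * t] leaves at most [e / 2]. *)
pose t := e / (2 * (L + 1)).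
have t0 : 0 < t by rewrite divr_gt0// mulr_gt0// ltr_wpDl.
have te0 : 0 < t * e / 4 by rewrite divr_gt0// mulr_gt0.
have [N _ hN] := near_infty_natSinv_lt (PosNum te0).
exists N => // n /= Nn; have {hN} /= hN := hN n Nn.
(* The potentials of the [p n] stay below that of [theta], so the difference is nonnegative and only
   an upper bound remains. *)
have ge0 := inner_le_potential (Ep n) Et El (ptheta n).
rewrite ger0_norm ?subr_ge0//.
have hadd : Eplus_on kappa A (measure_add (p n) (mscale (NngNum (ltW t0)) lam')).
  apply: Eplus_on_add => //.
  exact: Eplus_on_scale.
have := pmin n _ hadd; rewrite (sqdist_add_scale _ Et (Ep n) El') /=.
rewrite -/L => min.
have D' : inner theta lam' - inner (p n) lam' <= e / 2.
  have tL : t * L <= e / 2.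
    rewrite /t invfM mulrA mulrAC ler_pdivrMr ?ltr_wpDl//.
    by rewrite ler_wpM2l ?lerDl// ltW// divr_gt0.
  have : t * (2 * (inner theta lam' - inner (p n) lam')) <= t * (e / 2 + t * L).
    have -> : t * (e / 2 + t * L) = 2 * (t * e / 4) + t ^+ 2 * L by field.
    move: hN min; set u := n.+1%:R^-1; lra.
  rewrite ler_pM2l//; lra.
have := inner_cauchy_schwarz Et (Ep n) El El'.
move=> /(le_trans (ler_norm _)) cs.
have h2 : dist theta (p n) * dist lam lam' <= e / 2.
  apply: (@le_trans _ _ (c * (e / 2 / c))); last by rewrite mulrC divfK ?gt_eqF.
  apply: ler_pM; [exact: strong_dist_ge0|exact: strong_dist_ge0| |exact: ltW].
  by apply: le_trans (pnorm n) _; rewrite lerDl.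
lra.
Qed.

(** * Balayage of unit masses integrated against [omega] *)

Section balayage_of_unit_masses.
Variables (A : set X) (omega omegaA : borel_measure X R).
Variable epsA : X -> borel_measure X R.
Local Notation Omega := (~` closure A).
Hypothesis homega : Mplus_on Omega omega.
Hypothesis bomega : inner_balayage kappa A omega omegaA.
Hypothesis beps : forall x, Omega x -> inner_balayage kappa A (unit_mass x) (epsA x).

Lemma Omega_measurable : measurable (Omega : set (borel X)).
Proof. by apply: borel_open; apply: closed_openC; exact: closed_closure. Qed.

(** The family [epsA] comes without any measurability in [x]. These increasing measurable
    approximants, potentials of measures carried by [A], supply it together with the value of the
    integral. *)
Lemma potential_epsA theta : E theta ->
  exists g : nat -> X -> \bar R,
  [/\ forall n, measurable_fun [set: borel X] (g n),
      forall n x, (0 <= g n x)%E,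
      forall x, {homo g^~ x : m n / (m <= n)%N >-> (m <= n)%E},
      forall x, Omega x -> g n x @[n --> \oo] --> (inner theta (epsA x))%:E &
      (\int[omega]_(x in Omega) g n x)%E @[n --> \oo] --> (inner theta omegaA)%:E].
Proof.
move=> Et; have [p [pA pmono plim]] := balayage_approx A Et.
have Ep n := (pA n).1.
exists (fun n => U (p n)); split.
- by move=> n; exact: (potential_measurable (Ep n).1).
- by move=> n x; exact: potential_ge0.
- by move=> x m n mn; exact: pmono.
- move=> x Ox; have [beE ne] := beps Ox.
  have -> : (fun n => U (p n) x) = (fun n => (inner (p n) (epsA x))%:E).
    apply/funext => n; rewrite -(inner_fin (Ep n) beE.1).
    rewrite (balayage_inner (unit_mass_Mplus x) beE.1.1 ne (pA n)).
    by rewrite (mutual_energy_unit_mass x (Ep n).1).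
  by apply: cvg_EFin; [exact: nearW|exact: plim].
- have [bE ne] := bomega; have [Mom nom] := homega.
  have mclA : measurable (closure A : set (borel X)).
    by apply: borel_closed; exact: closed_closure.
  (* This turns the integral over [Omega] into one over the whole space, that is, into a mutual
     energy. *)
  have om0 : omega (closure A) = 0%E.
    apply/negligibleP; first exact: mclA.
    by rewrite -[closure A]setCK.
  have -> : (fun n => \int[omega]_(x in Omega) U (p n) x)%E =
      (fun n => (inner (p n) omegaA)%:E).
    apply/funext => n; rewrite -(inner_fin (Ep n) bE.1).
    rewrite (balayage_inner Mom bE.1.1 ne (pA n)).
    rewrite (mutual_energyC (Ep n).1 Mom).
    rewrite (mutual_energyE Mom (Ep n).1).
    rewrite [RHS](@ge0_negligible_integral _ _ _ omega setT (closure A))//.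
    - by rewrite setTD.

    - exact: (potential_measurable (Ep n).1).
    - by move=> x _; exact: potential_ge0.
  by apply: cvg_EFin; [exact: nearW|exact: plim].
Qed.

Lemma inner_epsA_measurable theta : E theta ->
  measurable_fun (Omega : set (borel X)) (fun x => (inner theta (epsA x))%:E).
Proof.
move=> /potential_epsA[g [mg _ _ gcvg _]].
have mg' n : measurable_fun (Omega : set (borel X)) (g n) by exact: measurable_funTS.
have := @emeasurable_fun_cvg _ (borel X) R Omega g _ mg' gcvg.
exact.
Qed.

Lemma integral_inner_epsA theta : E theta ->
  (\int[omega]_(x in Omega) (inner theta (epsA x))%:E)%E = (inner theta omegaA)%:E.
Proof.
move=> /potential_epsA[g [mg g0 gmono gcvg gint]].
have := @cvg_monotone_convergence _ _ _ omega _ Omega_measurable g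
  (fun n => measurable_funTS (mg n)) (fun n x _ => g0 n x) (fun x _ => gmono x).
have -> : (\int[omega]_(x in Omega) limn (g^~ x) =
    \int[omega]_(x in Omega) (inner theta (epsA x))%:E)%E.
  apply: eq_integral => x; rewrite inE => Ox.
  by apply/cvg_lim => //; exact: gcvg.
by move=> /(cvg_unique _) /(_ gint); apply.
Qed.

End balayage_of_unit_masses.

(** * Test functions that are potentials *)

Hypothesis hR4 : R4 kappa.

Definition represents (s : borel_measure X R * borel_measure X R) (phi : X -> R) :=
  [/\ E s.1, E s.2, C0 phi & forall x, (U s.1 x - U s.2 x)%E = (phi x)%:E].

Lemma finite_energy_Eplus s : finite_energy kappa s -> E s.1 /\ E s.2.
Proof.
move=> [[h1 h2 _] _]; rewrite /signed_energy /mutual_energy_pos /mutual_energy_neg.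
have := mutual_energy_ge0 h1 h1.
have := mutual_energy_ge0 h2 h2.
have := mutual_energy_ge0 h1 h2.
have := mutual_energy_ge0 h2 h1.
rewrite /Eplus /= /energy.
move: (I s.1 s.1) (I s.2 s.2) (I s.1 s.2) (I s.2 s.1) => a b c d.
(* Since [+oo - +oo] is [-oo], a single infinite term already makes the signed energy infinite. *)
case: a => [a| |]//; case: b => [b| |]//; case: c => [c| |]//; case: d => [d| |]// _ _ _ _ _;
  by split; split => //; rewrite ltry.
Qed.

Lemma represents_dense (w : @weight R X) (phi : X -> R) (e : R) :
  C0 phi -> 0 < e -> exists s psi, represents s psi /\
    forall x, `|psi x - phi x| <= e * weight_fun w x.
Proof.
move=> hphi e0; have [psi [hpsi [s fs sE]] h] := dense_in_C0_weighted w hR4 hphi e0.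
have [E1 E2] := finite_energy_Eplus fs.
by exists s, psi.
Qed.

Lemma represents_integral s phi lam : represents s phi -> E lam ->
  (\int[lam]_x (phi x)%:E)%E = (inner s.1 lam - inner s.2 lam)%:E.
Proof.
move=> [E1 E2 hphi sE] El.
have intU mu : E mu -> lam.-integrable [set: borel X] (U mu).
  move=> Em; have mU := potential_measurable Em.1.
  apply/integrableP; split => //.
  under eq_integral do rewrite gee0_abs ?potential_ge0//.
  by rewrite -(mutual_energyE El.1 Em.1) (inner_fin El Em) ltry.
under eq_integral do rewrite -sE.
rewrite (integralB measurableT (intU _ E1) (intU _ E2)).
rewrite -(mutual_energyE El.1 E1.1) -(mutual_energyE El.1 E2.1).
rewrite (inner_fin El E1) (inner_fin El E2).
by rewrite (innerC E1 El) (innerC E2 El).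
Qed.

(** Around each point a bump is approximated by a difference [psi] of two potentials. The first of
    them dominates [psi] because the second is nonnegative, and countably many of the open sets
    where [psi] exceeds one half cover the space. *)
Lemma covering_potentials : exists (eta : nat -> borel_measure X R) (O : nat -> set X),
  [/\ forall n, E (eta n), forall n, open (O n), \bigcup_n O n = setT &
      forall n x, O n x -> ((2^-1)%:E <= U (eta n) x)%E].
Proof.
have w1c (K : set X) : compact K -> exists2 c : R, 0 < c & forall x, K x -> c <= 1.
  by move=> _; exists 1.
pose w1 : weight := Weight (fun x : X => ltr01 : 0 < (fun=> 1) x) w1c.
have /choice[sp spP] (x : X) : exists sp : (borel_measure X R * borel_measure X R) * (X -> R),
    represents sp.1 sp.2 /\ 2^-1 < sp.2 x.
  have [phi [hphi _ phi1 _]] := bump openT (Logic.I : [set: X] x).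
  (* An error of one quarter leaves [psi x] at least three quarters, above the threshold one
     half. *)
  have e0 : 0 < 4^-1 :> R by rewrite invr_gt0.
  have [s [psi [hs h]]] := represents_dense w1 hphi e0.
  exists (s, psi); split => //=.
  have := h x; rewrite phi1 /= mulr1 ler_norml => /andP[+ _]; lra.
pose O x := [set y | 2^-1 < (sp x).2 y].
have [u uP] : exists u : nat -> X,
    [set: X] `<=` \bigcup_(n in [set n | [set: X] (u n)]) O (u n).
  apply: lindelof => x _; have [[_ _ [cpsi _] _] lt] := spP x.
  by split => //; move/continuousP : cpsi => /(_ _ (@open_gt R 2^-1)).
exists (fun n => (sp (u n)).1.1), (fun n => O (u n)); split.
- by move=> n; have [[]] := spP (u n).
- move=> n; have [[_ _ [cpsi _] _] lt] := spP (u n).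
  by move/continuousP : cpsi => /(_ _ (@open_gt R 2^-1)).
- by apply/seteqP; split => // x /uP[n _ Ox]; exists n.
- move=> n x Ox; have [[_ _ _ sE] _] := spP (u n).
  apply: (@le_trans _ _ ((sp (u n)).2 x)%:E); first by rewrite lee_fin ltW.
  by rewrite -sE; apply: geeDl; rewrite leeNl oppe0; exact: potential_ge0.
Qed.

(* With [c n = 2^-(n+1) / (1 + ||eta n||)], Cauchy-Schwarz bounds the series of the
   [c n * inner (eta n) lam] uniformly in [lam], hence for all [epsA x] at once. *)
Lemma weight_below_potentials : exists (eta : nat -> borel_measure X R)
    (c : nat -> R) (w : @weight R X),
  [/\ forall n, E (eta n), forall n, 0 <= c n,
      forall lam, E lam ->
        (\sum_(0 <= n <oo) (c n * inner (eta n) lam)%:E <= (enorm lam)%:E)%E &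
      forall x, ((weight_fun w x)%:E <= \sum_(0 <= n <oo) (c n)%:E * U (eta n) x)%E].
Proof.
have [eta [V [Eeta oV VT VU]]] := covering_potentials.
have en0 mu : 0 <= enorm mu by exact: sqrtr_ge0.
pose c n : R := ((2 ^ n.+1)%:R)^-1 / (1 + enorm (eta n)).
have d0 n : 0 < 1 + enorm (eta n) by rewrite ltr_wpDr.
have p0 n : 0 < ((2 ^ n.+1)%:R)^-1 :> R by rewrite invr_gt0 ltr0n expn_gt0.
have c0 n : 0 < c n by rewrite divr_gt0.
pose G x := (\sum_(0 <= n <oo) (c n)%:E * U (eta n) x)%E.
have t0 n x : (0 <= (c n)%:E * U (eta n) x)%E.
  by rewrite mule_ge0 ?lee_fin ?(ltW (c0 n))// potential_ge0.
have GV n x : V n x -> ((c n / 2)%:E <= G x)%E.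
  move=> Ox; apply: (@le_trans _ _ ((c n)%:E * U (eta n) x)%E).
    by rewrite EFinM lee_pmul2l ?lte_fin ?c0// VU.
  apply: le_trans (@nneseries_lim_ge _ _ predT 0 n.+1 (fun n _ _ => t0 n x)).
  rewrite big_nat_recr//= leeDr// sume_ge0//.
(* [G] may be infinite; truncation at 1 gives a real weight below the series. *)
pose w x := fine (mine (G x) 1%E).
have G0 x : (0 <= G x)%E by apply: nneseries_ge0.
have wE x : (w x)%:E = mine (G x) 1%E.
  rewrite /w fineK// ge0_fin_numE ?le_min ?G0 ?lee01//.
  by rewrite gt_min ltry orbT.
have w0 x : 0 < w x.
  have [n _ Ox] : (\bigcup_n V n) x by rewrite VT.
  rewrite -lte_fin wE lt_min lte01 andbT.
  by apply: lt_le_trans (GV n x Ox); rewrite lte_fin divr_gt0.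
(* A compact set is covered by finitely many [V n], and [G] is at least the smallest of the
   corresponding [c n / 2] on it. *)
have low N : exists2 b, 0 < b & forall n, (n < N)%N -> b <= c n / 2.
  elim: N => [|N [b b0 hb]]; first by exists 1.
  exists (Num.min b (c N / 2)); first by rewrite lt_min b0 divr_gt0.
  move=> n; rewrite ltnS leq_eqVlt => /predU1P[->|nN].
    by rewrite ge_min lexx orbT.
  by rewrite ge_min hb.
have wK K : compact K -> exists2 b : R, 0 < b & forall x, K x -> b <= w x.
  rewrite compact_cover => cK.
  have KV : K `<=` cover setT V by rewrite /cover VT.
  have [D _ KD] := cK nat setT V (fun i _ => oV i) KV.
  have [b b0 hb] := low (\max_(i <- finmap.enum_fset D) i).+1.
  exists (Num.min b 1); first by rewrite lt_min b0 ltr01.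
  move=> x /KD[i /= iD Ox]; rewrite -lee_fin wE EFin_min le_min.
  rewrite ge_min [X in _ && X]ge_min lexx orbT andbT.
  apply/orP; left; apply: le_trans (GV i x Ox); rewrite lee_fin; apply: hb.
  by rewrite ltnS; apply: leq_bigmax_seq.
exists eta, c, (Weight w0 wK); split => //.
- by move=> n; exact: ltW.
- move=> lam El.
  apply: le_trans (epsilon_trick0 predT (en0 lam)); apply: lee_nneseries.
    move=> n _ _; rewrite lee_fin mulr_ge0 ?(ltW (c0 n))//.
    exact: inner_ge0.
  move=> n _; rewrite lee_fin /c mulrAC -mulrA mulrC.
  rewrite ler_pM2r// mulrC ler_pdivrMl//.
  apply: (@le_trans _ _ (enorm (eta n) * enorm lam)).
    exact: inner_le_enorm.
  by rewrite ler_wpM2r// lerDr.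
- by move=> x; rewrite /= wE ge_min lexx.
Qed.

(** The difference of the two functions lies pointwise below [e] times the series of potentials,
    which is integrated term by term. *)
Lemma weighted_integral_diff (eta : nat -> borel_measure X R) (c : nat -> R)
    (w : X -> R) (phi psi : X -> R) (e : R) lam :
  (forall n, E (eta n)) -> (forall n, 0 <= c n) ->
  (forall x, ((w x)%:E <= \sum_(0 <= n <oo) (c n)%:E * U (eta n) x)%E) ->
  C0 phi -> C0 psi -> 0 <= e -> (forall x, `|psi x - phi x| <= e * w x) -> E lam ->
  (`|\int[lam]_x (psi x)%:E - \int[lam]_x (phi x)%:E| <=
    e%:E * \sum_(0 <= n <oo) (c n * inner (eta n) lam)%:E)%E.
Proof.
move=> Eeta c0 hw hphi hpsi e0 h El.
have iphi := C0_integrable El.1 hphi; have ipsi := C0_integrable El.1 hpsi.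
have mphi := measurable_int _ iphi; have mpsi := measurable_int _ ipsi.
have mU n := potential_measurable (Eeta n).1.
have mcU n : measurable_fun [set: borel X] (fun x => (c n)%:E * U (eta n) x)%E.
  exact: measurable_funeM.
have cU0 n x : (0 <= (c n)%:E * U (eta n) x)%E.
  by rewrite mule_ge0 ?lee_fin// potential_ge0.
have mG : measurable_fun [set: borel X]
    (fun x => \sum_(0 <= n <oo) (c n)%:E * U (eta n) x)%E.
  exact: ge0_emeasurable_sum.
rewrite -(integralB measurableT ipsi iphi).
apply: le_trans (le_abse_integral _ measurableT _) _.
  exact: emeasurable_funB.
apply: (@le_trans _ _
   (\int[lam]_x (e%:E * \sum_(0 <= n <oo) (c n)%:E * U (eta n) x))%E).
  apply: ge0_le_integral => //.
  - by apply: measurableT_comp => //; exact: emeasurable_funB.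
  - exact: measurable_funeM.
  - move=> x _; rewrite -EFinB abse_EFin.
    apply: (@le_trans _ _ (e%:E * (w x)%:E)%E); first by rewrite -EFinM lee_fin.
    by rewrite lee_wpmul2l// lee_fin.
rewrite ge0_integralZl//; last by move=> x _; exact: nneseries_ge0.
rewrite lee_wpmul2l ?lee_fin// integral_nneseries//.
apply: lee_nneseries => [n _ _|n _]; first exact: integral_ge0.
rewrite ge0_integralZl//; last 2 first.
  - by move=> x _; exact: potential_ge0.
  - by rewrite lee_fin.
rewrite -(mutual_energyE El.1 (Eeta n).1).
by rewrite (inner_fin El (Eeta n)) (innerC El (Eeta n)).
Qed.

(** * The representation for arbitrary test functions *)

Lemma inner_balayage_representation (A : set X) (omega omegaA : borel_measure X R)
    (epsA : X -> borel_measure X R) : Mplus_on (~` closure A) omega ->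
  inner_balayage kappa A omega omegaA ->
  (forall x, (~` closure A) x -> inner_balayage kappa A (unit_mass x) (epsA x)) ->
  integral_representation omegaA (~` closure A) omega epsA.
Proof.
move=> homega bomega beps phi hphi.
have mO : measurable (~` closure A : set (borel X)) := Omega_measurable A.
set Om : set (borel X) := ~` closure A in mO beps *.
have Eom : E omegaA by case: bomega => -[].
have Eeps x : Om x -> E (epsA x) by move=> /beps[[]].
have minner theta : E theta ->
    measurable_fun Om (fun x => (inner theta (epsA x))%:E).
  exact: (inner_epsA_measurable homega bomega beps).
have iinner theta : E theta ->
    (\int[omega]_(x in Om) (inner theta (epsA x))%:E)%E = (inner theta omegaA)%:E.
  exact: (integral_inner_epsA homega bomega beps).
have inner0 theta x : E theta -> Om x -> (0 <= (inner theta (epsA x))%:E)%E.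
  by move=> Et Ox; rewrite lee_fin; apply: inner_ge0 => //; exact: Eeps.
have intinner theta : E theta -> omega.-integrable Om (fun x => (inner theta (epsA x))%:E).
  move=> Et; apply/integrableP; split; first exact: minner.
  rewrite (_ : (\int[omega]_(x in Om) _)%E = (inner theta omegaA)%:E) ?ltry//.
  rewrite -(iinner theta Et); apply: eq_integral => x /set_mem Ox.
  by rewrite gee0_abs//; exact: inner0.
have [eta [c [w [Eeta c0 cle hw]]]] :=
  weight_below_potentials.
(* [J] controls the approximation error at every point of [Om]. It is integrable because its
   integral is the same series taken at [omegaA], hence at most [enorm omegaA]. *)
pose J x := (\sum_(0 <= n <oo) (c n * inner (eta n) (epsA x))%:E)%E.
have mJn n : measurable_fun Om (fun x => (c n * inner (eta n) (epsA x))%:E).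
  under eq_fun do rewrite EFinM.
  by apply: measurable_funeM; exact: minner.
have Jn0 n x : Om x -> (0 <= (c n * inner (eta n) (epsA x))%:E)%E.
  by move=> Ox; rewrite EFinM mule_ge0 ?lee_fin ?c0//; exact: inner0.
have J0 x : Om x -> (0 <= J x)%E by move=> Ox; apply: nneseries_ge0 => n _ _; exact: Jn0.
have mJ : measurable_fun Om J by apply: ge0_emeasurable_sum => // n x Ox _; exact: Jn0.
have intJ : omega.-integrable Om J.
  apply/integrableP; split => //.
  rewrite (_ : (\int[omega]_(x in Om) _)%E = \int[omega]_(x in Om) J x)%E; last first.
    by apply: eq_integral => x /set_mem Ox; rewrite gee0_abs// J0.
  rewrite integral_nneseries//.
  apply: le_lt_trans (ltry (enorm omegaA)); apply: le_trans (cle _ Eom).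
  apply: lee_nneseries => n; first by move=> _ _; apply: integral_ge0 => x; exact: Jn0.
  move=> _; under eq_integral do rewrite EFinM.
  rewrite ge0_integralZl ?lee_fin ?c0//.
  - by rewrite iinner.
  - exact: minner.
  - by move=> x; exact: inner0.
have Jfin x : Om x -> J x \is a fin_num.
  move=> Ox; rewrite ge0_fin_numE ?J0//.
  exact: le_lt_trans (cle _ (Eeps x Ox)) (ltry _).
have pos j : 0 < j.+1%:R^-1 :> R by rewrite invr_gt0.
have /choice[sp spP] j : exists sp : (borel_measure X R * borel_measure X R) * (X -> R),
    represents sp.1 sp.2 /\
    forall x, `|sp.2 x - phi x| <= j.+1%:R^-1 * weight_fun w x.
  have [s [psi h]] := represents_dense w hphi (pos j).
  by exists (s, psi).
pose s j := (sp j).1; pose psi j := (sp j).2.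
have hpsi j : C0 (psi j) by case: (spP j) => -[].
have Es1 j : E (s j).1 by case: (spP j) => -[].
have Es2 j : E (s j).2 by case: (spP j) => -[].
have psiE j lam : E lam ->
    (\int[lam]_x (psi j x)%:E)%E = (inner (s j).1 lam - inner (s j).2 lam)%:E.
  by move=> El; apply: (represents_integral _ El); case: (spP j).
have diff j lam : E lam -> (`|\int[lam]_x (psi j x)%:E - \int[lam]_x (phi x)%:E| <=
    j.+1%:R^-1%:E * \sum_(0 <= n <oo) (c n * inner (eta n) lam)%:E)%E.
  move=> El; apply: (weighted_integral_diff Eeta c0 hw hphi (hpsi j) _ _ El).
    exact: ltW.
  by case: (spP j).
have phifin lam : E lam -> (\int[lam]_x (phi x)%:E)%E \is a fin_num.
  move=> El; exact: (integrable_fin_num measurableT (C0_integrable El.1 hphi)).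
have diffr j lam : E lam -> `|inner (s j).1 lam - inner (s j).2 lam -
      fine (\int[lam]_x (phi x)%:E)%E| <=
    j.+1%:R^-1 * fine (\sum_(0 <= n <oo) (c n * inner (eta n) lam)%:E)%E.
  move=> El; have := diff j lam El; rewrite psiE//.
  have sfin : (\sum_(0 <= n <oo) (c n * inner (eta n) lam)%:E)%E \is a fin_num.
    rewrite ge0_fin_numE; first exact: le_lt_trans (cle _ El) (ltry _).
    apply: nneseries_ge0 => n _ _; rewrite lee_fin mulr_ge0 ?c0//.
    exact: inner_ge0.
  by rewrite -{1}(fineK (phifin _ El)) -{1}(fineK sfin) -EFinB abse_EFin -EFinM lee_fin.
pose f_ j x := (\int[epsA x]_y (psi j y)%:E)%E.
pose f x := (\int[epsA x]_y (phi y)%:E)%E.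
have f_E j x : Om x ->
    f_ j x = ((inner (s j).1 (epsA x))%:E - (inner (s j).2 (epsA x))%:E)%E.
  by move=> Ox; rewrite /f_ psiE ?EFinB//; exact: Eeps.
have intf_ j : omega.-integrable Om (f_ j).
  apply: (eq_integrable mO); last first.
    by apply: (integrableB mO (intinner _ (Es1 j)) (intinner _ (Es2 j))).
  by move=> x /set_mem Ox; rewrite f_E.
have mf_ j : measurable_fun Om (f_ j) := measurable_int _ (intf_ j).
have f_int j : (\int[omega]_(x in Om) f_ j x)%E = (\int[omegaA]_x (psi j x)%:E)%E.
  rewrite psiE// EFinB -(iinner _ (Es1 j)) -(iinner _ (Es2 j)).
  rewrite -(integralB mO (intinner _ (Es1 j)) (intinner _ (Es2 j))).
  by apply: eq_integral => x /set_mem Ox; rewrite f_E.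
have f_f x : Om x -> f_ j x @[j --> \oo] --> f x.
  move=> Ox; have Ex := Eeps x Ox.
  rewrite /f -(fineK (phifin _ Ex)).
  rewrite (_ : (fun j => f_ j x) = (fun j =>
     (inner (s j).1 (epsA x) - inner (s j).2 (epsA x))%:E)); last first.
    by apply/funext => j; rewrite f_E.
  apply: cvg_EFin; first exact: nearW.
  by apply: cvg_le_harmonic => j; exact: diffr.
have mf : measurable_fun Om f := @emeasurable_fun_cvg _ (borel X) R Om f_ f mf_ f_f.
(* The distance from [f_ j] to [f_ 0] is at most the sum of their distances to [f], and each of
   these is at most [J]. *)
pose g x := (`|f_ 0%N x| + 2%:E * J x)%E.
have intg : omega.-integrable Om g.
  apply: integrableD => //; first exact: integrable_abse.
  exact: integrableZl.
have fg j x : Om x -> (`|f_ j x| <= g x)%E.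
  move=> Ox; have Ex := Eeps x Ox; rewrite /g !f_E// -!EFinB !abse_EFin.
  rewrite -(fineK (Jfin x Ox)) -EFinM -EFinD lee_fin.
  have h0 := diffr 0%N _ Ex; have hj := diffr j _ Ex.
  rewrite -/(J x) in h0 hj.
  have b0 : 0 <= fine (J x) by apply: fine_ge0; exact: J0.
  have j1 : j.+1%:R^-1 * fine (J x) <= fine (J x).
    by rewrite ler_piMl// invf_le1// ler1n.
  rewrite invr1 mul1r in h0.
  move: h0 hj j1 b0; move: (fine (J x)) (fine _) (_ * _) => b l r.
  move: (inner (s 0%N).1 _ - _) (inner (s j).1 _ - _) => a0 aj h0 hj j1 b0.
  have -> : aj = (aj - l) - (a0 - l) + a0 by ring.
  apply: le_trans (ler_normD _ _) _; rewrite addrC lerD2l.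
  by apply: le_trans (ler_normB _ _) _; lra.
have [intf _ cvgf] := dominated_convergence mO mf_ mf (aeW omega f_f) intg
  (aeW omega (fun x j Ox => fg j x Ox)).
split; first exact: intf.
(* The same error bound at the single measure [omegaA] gives the limit of the integrals of the
   [psi j]; both limits must coincide. *)
have cvgA : (\int[omegaA]_x (psi j x)%:E)%E @[j --> \oo] --> (\int[omegaA]_x (phi x)%:E)%E.
  rewrite -(fineK (phifin _ Eom)).
  under eq_fun do rewrite psiE//.
  apply: cvg_EFin; first exact: nearW.
  by apply: cvg_le_harmonic => j; exact: diffr.
move: cvgf; rewrite [X in X @ \oo --> _ -> _](_ : _ =
  (fun j => \int[omegaA]_x (psi j x)%:E)%E); last exact/funext.
by move=> /(cvg_unique _ cvgA); apply.
Qed.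

End lch_space.

(** * Conclusion for inner and outer balayage *)

Unset Implicit Arguments.
Set Strict Implicit.
Set Printing Implicit Defensive.

Local Close Scope ring_scope.
Local Open Scope classical_set_scope.
Local Open Scope ereal_scope.

Theorem theorem1p5 (R : realType) (X : ptopologicalType)
    (kappa : X -> X -> \bar R) (A : set X) (omega : borel_measure X R)
    (hX : hausdorff_space X) (lcX : locally_compact [set: X])
    (scX : second_countable (T := X))
    (hkappa : is_kernel kappa) (hen : energy_principle kappa)
    (h1 : R1 kappa) (h2 : R2 kappa) (h3 : R3 kappa) (h4 : R4 kappa)
    (hcap : 0 < inner_cap kappa A) (hA : closure A <> [set: X])
    (homega : Mplus_on (~` closure A) omega)
    (homega0 : ~ zero_measure omega)
    (hfin : energy kappa omega < +oo \/ omega [set: X] < +oo) :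
  (forall nu1 nu2 : borel_measure X R,
     inner_balayage kappa A omega nu1 -> inner_balayage kappa A omega nu2 ->
     same_measure nu1 nu2)
  /\
  (forall (omegaA : borel_measure X R) (epsA : X -> borel_measure X R),
     inner_balayage kappa A omega omegaA ->
     (forall x, (~` closure A) x -> inner_balayage kappa A (unit_mass x) (epsA x)) ->
     integral_representation omegaA (~` closure A) omega epsA)
  /\
  (measurable (A : set (borel X)) ->
   forall (omegaA : borel_measure X R) (epsA : X -> borel_measure X R),
     outer_balayage kappa A omega omegaA ->
     (forall x, (~` closure A) x -> outer_balayage kappa A (unit_mass x) (epsA x)) ->
     integral_representation omegaA (~` closure A) omega epsA).
Proof.
have [[_ hcomplete hfiner] hdom _] := h1.
have hom : Mplus omega by case: homega.
have repr omegaA epsA : inner_balayage kappa A omega omegaA ->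
    (forall x, (~` closure A) x -> inner_balayage kappa A (unit_mass x) (epsA x)) ->
    integral_representation omegaA (~` closure A) omega epsA.
  exact: (inner_balayage_representation hX lcX scX hkappa hen hcomplete hfiner hdom h4).
split; last split.
- move=> nu1 nu2; exact: (inner_balayage_unique hX lcX scX hkappa hen hom).
- exact: repr.
(* Outer capacity zero implies inner capacity zero, so each outer balayage is also an inner one. *)
- move=> _ omegaA epsA [hA' hq] heps; apply: repr.
    by split => //; exact: (quasi_nearly_everywhere hX lcX scX hkappa).
  move=> x /heps[hx hxq]; split => //.
  exact: (quasi_nearly_everywhere hX lcX scX hkappa).
Qed.
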